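(* Let $\mathbb{K}$ be an infinite field of characteristic different from $2$ and let $J$ be a $T_{\mathbb{Z}_2}$-ideal of $\mathcal{L}(X^{\mathbb{Z}_2})$ such that $\mathrm{Id}_{\mathbb{Z}_2}(\mathrm{UT}_3^{(-)}(\mathbb{K}),\Gamma(1,1))\subseteq J$. Then $J$ is finitely generated as a $T_{\mathbb{Z}_2}$-ideal.
   Context: $\mathrm{UT}_3^{(-)}=\mathrm{UT}_3(\mathbb{K})^{(-)}$ is the Lie algebra of upper triangular $3\times3$ matrices over $\mathbb{K}$ with bracket $[a,b]=ab-ba$; $e_{ij}$ are matrix units. $\mathbb{Z}_2=\{0,1\}$ is the cyclic group of order 2 in additive notation, and $\Gamma(1,1)$ is the $\mathbb{Z}_2$-grading on $\mathrm{UT}_3^{(-)}$ with $\deg e_{ii}=\deg e_{13}=0$ and $\deg e_{12}=\deg e_{23}=1$. $\mathcal{L}(X^{\mathbb{Z}_2})$ is the free $\mathbb{Z}_2$-graded Lie algebra over $\mathbb{K}$ freely generated by countably many variables $y_i$ ($i\in\mathbb{N}$) of degree $0$ and $z_i$ ($i\in\mathbb{N}$) of degree $1$. $\mathrm{Id}_{\mathbb{Z}_2}(\mathrm{UT}_3^{(-)},\Gamma)$ is the set of elements of $\mathcal{L}(X^{\mathbb{Z}_2})$ that vanish under every graded homomorphism to $(\mathrm{UT}_3^{(-)},\Gamma)$. A $T_{\mathbb{Z}_2}$-ideal is an ideal of $\mathcal{L}(X^{\mathbb{Z}_2})$ invariant under all graded endomorphisms. *)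

(* Defs.v *)
From HB Require Import structures.
From mathcomp Require Import all_boot all_order all_algebra.
From mathcomp Require Import all_classical.

Set Implicit Arguments.
Unset Strict Implicit.
Unset Printing Implicit Defensive.

Import GRing.Theory.

Local Open Scope classical_set_scope.
Local Open Scope ring_scope.
Local Open Scope quotient_scope.

HB.mixin Record Lmodule_isLie (K : fieldType) L of GRing.Lmodule K L := {
  lie : L -> L -> L;
  lie_linearl : forall b, linear (lie^~ b);
  lie_linearr : forall a, linear (lie a);
  liexx : forall a, lie a a = 0;
  lie_jacobi : forall a b c,
    lie a (lie b c) + lie b (lie c a) + lie c (lie a b) = 0
}.

#[short(type="lieType")]
HB.structure Definition Lie (K : fieldType) :=
  { L of GRing.Lmodule K L & Lmodule_isLie K L }.

Section LieTheory.
Variables (K : fieldType) (L : lieType K).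
Implicit Types (a b c : L) (k : K).

Lemma lieDl a b c : lie (a + b) c = lie a c + lie b c.
Proof. by have := lie_linearl c 1 a b; rewrite !scale1r. Qed.

Lemma lieDr a b c : lie a (b + c) = lie a b + lie a c.
Proof. by have := lie_linearr a 1 b c; rewrite !scale1r. Qed.

Lemma lie0l a : lie 0 a = 0.
Proof. by apply: (addIr (lie 0 a)); rewrite -lieDl !add0r. Qed.

Lemma lie0r a : lie a 0 = 0.
Proof. by apply: (addIr (lie a 0)); rewrite -lieDr !add0r. Qed.

Lemma lieZl k a b : lie (k *: a) b = k *: lie a b.
Proof. by have := lie_linearl b k a 0; rewrite !addr0 lie0l addr0. Qed.

Lemma lieZr k a b : lie a (k *: b) = k *: lie a b.
Proof. by have := lie_linearr a k b 0; rewrite !addr0 lie0r addr0. Qed.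

Lemma lieC a b : lie a b = - lie b a.
Proof.
apply/eqP; rewrite -addr_eq0; have := liexx (a + b).
by rewrite lieDl !lieDr !liexx add0r addr0 => ->.
Qed.

End LieTheory.

Definition lie_hom (K : fieldType) (L M : lieType K) (f : L -> M) : Prop :=
  forall a b, f (lie a b) = lie (f a) (f b).

Section Gradings.
Variable K : fieldType.

Record grading (L : lieType K) := Grading {
  component :> 'Z_2 -> set L;
  component0 : forall g, component g 0;
  componentD : forall g a b,
    component g a -> component g b -> component g (a + b);
  componentZ : forall g (k : K) a, component g a -> component g (k *: a);
  component_span : forall a, exists a0 a1,
    [/\ component 0 a0, component 1 a1 & a = a0 + a1];
  component_direct : forall a, component 0 a -> component 1 a -> a = 0;
  component_lie : forall g h a b,
    component g a -> component h b -> component (g + h) (lie a b)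
}.

Definition graded_hom (L M : lieType K) (GL : grading L) (GM : grading M)
    (f : {linear L -> M}) : Prop :=
  lie_hom f /\ (forall g a, GL g a -> GM g (f a)).

End Gradings.

Lemma Z2P (g : 'Z_2) : g = 0 \/ g = 1.
Proof.
by case: g => [[|[|]]] // lt_g; [left | right]; apply/val_inj.
Qed.

Inductive lterm (K X : Type) :=
| LVar of X
| LZero
| LAdd of lterm K X & lterm K X
| LScale of K & lterm K X
| LBr of lterm K X & lterm K X.

Arguments LZero {K X}.
Arguments LVar {K X} x.

HB.instance Definition _ (K X : Type) := gen_eqMixin (lterm K X).
HB.instance Definition _ (K X : Type) := gen_choiceMixin (lterm K X).

Section FreeLie.
Variables (K : fieldType) (X : Type).
Implicit Types (s t u : lterm K X) (k l : K).

(* The least congruence whose quotient satisfies the Lie algebra axioms;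
   the additive inverse of t is LScale (-1) t. *)
Inductive lcong : lterm K X -> lterm K X -> Prop :=
| lcong_refl t : lcong t t
| lcong_sym s t : lcong s t -> lcong t s
| lcong_trans s t u : lcong s t -> lcong t u -> lcong s u
| lcong_add s s' t t' :
    lcong s s' -> lcong t t' -> lcong (LAdd s t) (LAdd s' t')
| lcong_scale k t t' : lcong t t' -> lcong (LScale k t) (LScale k t')
| lcong_br s s' t t' :
    lcong s s' -> lcong t t' -> lcong (LBr s t) (LBr s' t')
| lcong_addA s t u : lcong (LAdd s (LAdd t u)) (LAdd (LAdd s t) u)
| lcong_addC s t : lcong (LAdd s t) (LAdd t s)
| lcong_add0 t : lcong (LAdd LZero t) t
| lcong_addN t : lcong (LAdd (LScale (-1) t) t) LZero
| lcong_scaleA k l t : lcong (LScale k (LScale l t)) (LScale (k * l) t)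
| lcong_scale1 t : lcong (LScale 1 t) t
| lcong_scaleDr k s t :
    lcong (LScale k (LAdd s t)) (LAdd (LScale k s) (LScale k t))
| lcong_scaleDl k l t :
    lcong (LScale (k + l) t) (LAdd (LScale k t) (LScale l t))
| lcong_brl k s t u :
    lcong (LBr (LAdd (LScale k s) t) u) (LAdd (LScale k (LBr s u)) (LBr t u))
| lcong_brr k s t u :
    lcong (LBr u (LAdd (LScale k s) t)) (LAdd (LScale k (LBr u s)) (LBr u t))
| lcong_brxx t : lcong (LBr t t) LZero
| lcong_jacobi s t u :
    lcong (LAdd (LAdd (LBr s (LBr t u)) (LBr t (LBr u s))) (LBr u (LBr s t)))
      LZero.

Definition lcongb s t := `[< lcong s t >].

Lemma lcongb_refl : reflexive lcongb.
Proof. by move=> t; apply/asboolP/lcong_refl. Qed.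

Lemma lcongb_sym : symmetric lcongb.
Proof. by move=> s t; apply/asboolP/asboolP => /lcong_sym. Qed.

Lemma lcongb_trans : transitive lcongb.
Proof.
by move=> t s u /asboolP st /asboolP tu; apply/asboolP/(lcong_trans st tu).
Qed.

Canonical lcong_equiv := EquivRel lcongb lcongb_refl lcongb_sym lcongb_trans.

Definition freeLie : Type := {eq_quot lcongb}.

HB.instance Definition _ := EqQuotient.on freeLie.
HB.instance Definition _ := Choice.on freeLie.

Definition lcls t : freeLie := \pi_freeLie t.

Lemma lclsP s t : lcls s = lcls t <-> lcong s t.
Proof.
by split=> [/eqP|st]; [rewrite eqmodE => /asboolP|
  apply/eqP; rewrite eqmodE; apply/asboolP].
Qed.

Lemma lcls_repr (a : freeLie) : lcls (repr a) = a.
Proof. exact: reprK. Qed.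

Lemma repr_lcls t : lcong (repr (lcls t)) t.
Proof. by apply/lclsP; rewrite lcls_repr. Qed.

Definition fl_add (a b : freeLie) := lcls (LAdd (repr a) (repr b)).
Definition fl_scale k (a : freeLie) := lcls (LScale k (repr a)).
Definition fl_lie (a b : freeLie) := lcls (LBr (repr a) (repr b)).

Lemma fl_addE s t : fl_add (lcls s) (lcls t) = lcls (LAdd s t).
Proof. by apply/lclsP/lcong_add; apply: repr_lcls. Qed.

Lemma fl_scaleE k t : fl_scale k (lcls t) = lcls (LScale k t).
Proof. by apply/lclsP/lcong_scale; apply: repr_lcls. Qed.

Lemma fl_lieE s t : fl_lie (lcls s) (lcls t) = lcls (LBr s t).
Proof. by apply/lclsP/lcong_br; apply: repr_lcls. Qed.

Let flE := (fl_addE, fl_scaleE, fl_lieE).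

Lemma fl_addA : associative fl_add.
Proof.
move=> a b c; rewrite -(lcls_repr a) -(lcls_repr b) -(lcls_repr c) !flE.
exact/lclsP/lcong_addA.
Qed.

Lemma fl_addC : commutative fl_add.
Proof.
move=> a b; rewrite -(lcls_repr a) -(lcls_repr b) !flE.
exact/lclsP/lcong_addC.
Qed.

Lemma fl_add0 : left_id (lcls LZero) fl_add.
Proof. by move=> a; rewrite -(lcls_repr a) !flE; apply/lclsP/lcong_add0. Qed.

Lemma fl_addN : left_inverse (lcls LZero) (fl_scale (-1)) fl_add.
Proof. by move=> a; rewrite -(lcls_repr a) !flE; apply/lclsP/lcong_addN. Qed.

HB.instance Definition _ :=
  GRing.isZmodule.Build freeLie fl_addA fl_addC fl_add0 fl_addN.

Lemma fl_scaleA k l (a : freeLie) :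
  fl_scale k (fl_scale l a) = fl_scale (k * l) a.
Proof. by rewrite -(lcls_repr a) !flE; apply/lclsP/lcong_scaleA. Qed.

Lemma fl_scale1 : left_id 1 fl_scale.
Proof. by move=> a; rewrite -(lcls_repr a) !flE; apply/lclsP/lcong_scale1. Qed.

Lemma fl_scaleDr : right_distributive fl_scale +%R.
Proof.
move=> k a b; rewrite -[_ + _]/(fl_add _ _) -[RHS]/(fl_add _ _).
rewrite -(lcls_repr a) -(lcls_repr b) !flE.
exact/lclsP/lcong_scaleDr.
Qed.

Lemma fl_scaleDl (a : freeLie) : {morph fl_scale^~ a : k l / k + l}.
Proof.
move=> k l; rewrite -[RHS]/(fl_add _ _) -(lcls_repr a) !flE.
exact/lclsP/lcong_scaleDl.
Qed.

HB.instance Definition _ := GRing.Zmodule_isLmodule.Build K freeLie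
  fl_scaleA fl_scale1 fl_scaleDr fl_scaleDl.

Lemma lcls0 : lcls LZero = 0.
Proof. by []. Qed.

Lemma lclsD s t : lcls (LAdd s t) = lcls s + lcls t.
Proof. by rewrite -fl_addE. Qed.

Lemma lclsZ k t : lcls (LScale k t) = k *: lcls t.
Proof. by rewrite -fl_scaleE. Qed.

Lemma fl_lie_linearl (b : freeLie) : linear (fl_lie^~ b).
Proof.
move=> k a c; rewrite -(lcls_repr a) -(lcls_repr b) -(lcls_repr c).
by rewrite -lclsZ -lclsD !fl_lieE -lclsZ -lclsD; apply/lclsP/lcong_brl.
Qed.

Lemma fl_lie_linearr (a : freeLie) : linear (fl_lie a).
Proof.
move=> k b c; rewrite -(lcls_repr a) -(lcls_repr b) -(lcls_repr c).
by rewrite -lclsZ -lclsD !fl_lieE -lclsZ -lclsD; apply/lclsP/lcong_brr.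
Qed.

Lemma fl_liexx (a : freeLie) : fl_lie a a = 0.
Proof. by rewrite -(lcls_repr a) fl_lieE; apply/lclsP/lcong_brxx. Qed.

Lemma fl_lie_jacobi (a b c : freeLie) :
  fl_lie a (fl_lie b c) + fl_lie b (fl_lie c a) + fl_lie c (fl_lie a b) = 0.
Proof.
rewrite -(lcls_repr a) -(lcls_repr b) -(lcls_repr c) !fl_lieE -!lclsD.
exact/lclsP/lcong_jacobi.
Qed.

HB.instance Definition _ := Lmodule_isLie.Build K freeLie
  fl_lie_linearl fl_lie_linearr fl_liexx fl_lie_jacobi.

Lemma lclsB s t : lcls (LBr s t) = lie (lcls s) (lcls t).
Proof. by rewrite -fl_lieE. Qed.

Definition fvar (x : X) : freeLie := lcls (LVar x).

Lemma freeLie_ind (P : freeLie -> Prop) :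
  (forall x, P (fvar x)) -> P 0 -> (forall a b, P a -> P b -> P (a + b)) ->
  (forall k a, P a -> P (k *: a)) ->
  (forall a b, P a -> P b -> P (lie a b)) -> forall a, P a.
Proof.
move=> Pvar P0 PD PZ PB a; rewrite -(lcls_repr a); elim: (repr a) => //=.
- by move=> s Ps t Pt; rewrite lclsD; apply: PD.
- by move=> k t Pt; rewrite lclsZ; apply: PZ.
- by move=> s Ps t Pt; rewrite lclsB; apply: PB.
Qed.

Section Universal.
Variables (L : lieType K) (f : X -> L).

Fixpoint leval t : L := match t with
  | LVar x => f x
  | LZero => 0
  | LAdd s t => leval s + leval t
  | LScale k t => k *: leval t
  | LBr s t => lie (leval s) (leval t)
  end.

Lemma leval_lcong s t : lcong s t -> leval s = leval t.
Proof.
elim=> //=; clear; do ?by [move=> ? ? ? _ -> _ -> | move=> *; congruence].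
- by move=> s t u; rewrite addrA.
- by move=> s t; rewrite addrC.
- by move=> t; rewrite add0r.
- by move=> t; rewrite scaleN1r addNr.
- by move=> k l t; rewrite scalerA.
- by move=> t; rewrite scale1r.
- by move=> k s t; rewrite scalerDr.
- by move=> k l t; rewrite scalerDl.
- by move=> k s t u; rewrite lie_linearl.
- by move=> k s t u; rewrite lie_linearr.
- by move=> t; rewrite liexx.
- by move=> s t u; rewrite lie_jacobi.
Qed.

Definition free_ext (a : freeLie) : L := leval (repr a).

Lemma free_ext_lcls t : free_ext (lcls t) = leval t.
Proof. exact/leval_lcong/repr_lcls. Qed.

Lemma free_ext_linear : linear free_ext.
Proof.
move=> k a b; rewrite -(lcls_repr a) -(lcls_repr b) -lclsZ -lclsD.
by rewrite !free_ext_lcls.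
Qed.

HB.instance Definition _ :=
  GRing.isLinear.Build K freeLie L *:%R free_ext free_ext_linear.

Lemma free_ext_lie : lie_hom free_ext.
Proof.
move=> a b; rewrite -(lcls_repr a) -(lcls_repr b) -lclsB.
by rewrite !free_ext_lcls.
Qed.

Lemma free_extE x : free_ext (fvar x) = f x.
Proof. exact: free_ext_lcls. Qed.

Lemma free_ext_unique (phi : {linear freeLie -> L}) :
  lie_hom phi -> (forall x, phi (fvar x) = f x) -> phi =1 free_ext.
Proof.
move=> phiB phiv; elim/freeLie_ind => [x||a b IHa IHb|k a IHa|a b IHa IHb].
- by rewrite phiv free_extE.
- by rewrite !linear0.
- by rewrite !linearD IHa IHb.
- by rewrite !linearZ IHa.
- by rewrite phiB free_ext_lie IHa IHb.
Qed.

End Universal.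

End FreeLie.

Section GroupExtension.
Variables (K : fieldType) (L : lieType K).

(* L (x) K[Z_2]: (a, b) stands for a (x) 1 + b (x) g, with g the generator. *)
Definition z2ext : Type := (L * L)%type.

HB.instance Definition _ := GRing.Lmodule.on z2ext.

Definition z2ext_lie (a b : z2ext) : z2ext :=
  (lie a.1 b.1 + lie a.2 b.2, lie a.1 b.2 + lie a.2 b.1).

Lemma z2ext_linearl b : linear (z2ext_lie^~ b).
Proof.
case: b => b0 b1 k [a0 a1] [c0 c1]; congr pair => /=;
by rewrite !lie_linearl scalerDr addrACA.
Qed.

Lemma z2ext_linearr a : linear (z2ext_lie a).
Proof.
case: a => a0 a1 k [b0 b1] [c0 c1]; congr pair => /=;
by rewrite !lie_linearr scalerDr addrACA.
Qed.

Lemma z2ext_liexx a : z2ext_lie a a = 0.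
Proof.
case: a => a0 a1; congr pair => /=; first by rewrite !liexx addr0.
by rewrite [lie a1 a0]lieC subrr.
Qed.

Lemma z2ext_jacobi a b c :
  z2ext_lie a (z2ext_lie b c) + z2ext_lie b (z2ext_lie c a)
  + z2ext_lie c (z2ext_lie a b) = 0.
Proof.
case: a b c => [a0 a1] [b0 b1] [c0 c1].
pose J (x y z : L) := lie x (lie y z) + lie y (lie z x) + lie z (lie x y).
have J0 x y z : J x y z = 0 by apply: lie_jacobi.
congr pair => /=; rewrite !lieDr.
- transitivity (J a0 b0 c0 + J a0 b1 c1 + (J a1 b0 c1 + J a1 b1 c0)).
    rewrite /J.
    by rewrite !addrA [LHS](ACl ((1*5*9)*(2*8*11)*((3*6*12)*(4*7*10))))/= !addrA.
  by rewrite !J0 !addr0.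
- transitivity (J a0 b0 c1 + J a0 b1 c0 + (J a1 b0 c0 + J a1 b1 c1)).
    rewrite /J.
    by rewrite !addrA [LHS](ACl ((1*6*11)*(2*7*9)*((3*5*10)*(4*8*12))))/= !addrA.
  by rewrite !J0 !addr0.
Qed.

HB.instance Definition _ := Lmodule_isLie.Build K z2ext
  z2ext_linearl z2ext_linearr z2ext_liexx z2ext_jacobi.

End GroupExtension.

Section FreeGraded.
Variables (K : fieldType) (X : Type) (deg : X -> 'Z_2).

(* The components of the grading determined by the degrees of the generators:
   free_comp g is spanned by the brackets of generators of total degree g. *)
Inductive free_comp : 'Z_2 -> set (freeLie K X) :=
| free_comp_var x : free_comp (deg x) (fvar K x)
| free_comp0 g : free_comp g 0
| free_compD g a b :
    free_comp g a -> free_comp g b -> free_comp g (a + b)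
| free_compZ g (k : K) a : free_comp g a -> free_comp g (k *: a)
| free_comp_lie g h a b :
    free_comp g a -> free_comp h b -> free_comp (g + h) (lie a b).

Lemma free_comp_span a : exists a0 a1,
  [/\ free_comp 0 a0, free_comp 1 a1 & a = a0 + a1].
Proof.
elim/freeLie_ind: a => [x||a b|k a|a b].
- have := free_comp_var x; case: (Z2P (deg x)) => -> xg.
    by exists (fvar K x), 0; rewrite addr0; split=> //; apply: free_comp0.
  by exists 0, (fvar K x); rewrite add0r; split=> //; apply: free_comp0.
- by exists 0, 0; rewrite addr0; split=> //; apply: free_comp0.
- move=> [a0 [a1 [? ? ->]]] [b0 [b1 [? ? ->]]]; exists (a0 + b0), (a1 + b1).
  by rewrite addrACA; split=> //; apply: free_compD.
- move=> [a0 [a1 [? ? ->]]]; exists (k *: a0), (k *: a1).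
  by rewrite scalerDr; split=> //; apply: free_compZ.
- move=> [a0 [a1 [ha0 ha1 ->]]] [b0 [b1 [hb0 hb1 ->]]].
  exists (lie a0 b0 + lie a1 b1), (lie a0 b1 + lie a1 b0); split.
  + have := free_comp_lie ha0 hb0; rewrite addr0 => h00.
    have := free_comp_lie ha1 hb1; rewrite (_ : 1 + 1 = 0 :> 'Z_2) => [h11|].
      exact: free_compD.
    exact/val_inj.
  + have := free_comp_lie ha0 hb1; rewrite add0r => h01.
    have := free_comp_lie ha1 hb0; rewrite addr0 => h10.
    exact: free_compD.
  + rewrite lieDl !lieDr -!addrA; congr (_ + _).
    by rewrite [RHS]addrC -addrA.
Qed.

Definition z2inj (g : 'Z_2) (a : freeLie K X) : z2ext (freeLie K X) :=
  if g == 0 then (a, 0) else (0, a).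

Lemma free_comp_z2inj g a :
  free_comp g a -> free_ext (fun x => z2inj (deg x) (fvar K x)) a = z2inj g a.
Proof.
elim=> {g a} [x|g|g a b _ IHa _ IHb|g k a _ IHa|g h a b _ IHa _ IHb].
- by rewrite free_extE.
- by rewrite linear0 /z2inj; case: ifP.
- rewrite linearD /= IHa IHb /z2inj.
  by case: ifP => _; congr pair; rewrite /= addr0.
- rewrite linearZ /= IHa /z2inj.
  by case: ifP => _; congr pair; rewrite /= scaler0.
- rewrite free_ext_lie IHa IHb.
  case: (Z2P g) => ->; case: (Z2P h) => ->; rewrite /z2inj /=;
  by congr pair; rewrite /= !(lie0l, lie0r, addr0, add0r).
Qed.

Lemma free_comp_direct a : free_comp 0 a -> free_comp 1 a -> a = 0.
Proof.
by move=> /free_comp_z2inj e0 /free_comp_z2inj; rewrite e0 => /(congr1 fst).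
Qed.

Definition free_grading : grading (freeLie K X) :=
  Grading free_comp0 free_compD free_compZ free_comp_span free_comp_direct
    free_comp_lie.

Lemma free_ext_graded (L : lieType K) (G : grading L) (f : X -> L) :
  (forall x, G (deg x) (f x)) -> graded_hom free_grading G (free_ext f).
Proof.
move=> fG; split; first exact: free_ext_lie.
move=> g a; elim=> {g a} [x|g|g a b _ IHa _ IHb|g k a _ IHa|g h a b _ IHa _ IHb].
- by rewrite /= free_extE.
- by rewrite linear0; apply: component0.
- by rewrite linearD /=; apply: componentD.
- by rewrite linearZ /=; apply: componentZ.
- by rewrite /= free_ext_lie; apply: component_lie.
Qed.

End FreeGraded.

(* The variables y_i, of degree 0, and z_i, of degree 1. *)
Inductive gvar := YVar of nat | ZVar of nat.

Definition gvar_deg (x : gvar) : 'Z_2 := if x is YVar _ then 0 else 1.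

Definition freeGLie (K : fieldType) : lieType K := freeLie K gvar.

Definition freeGLie_grading (K : fieldType) : grading (freeGLie K) :=
  free_grading K gvar_deg.

Section TIdeals.
Variable K : fieldType.
Local Notation F := (freeGLie K).
Local Notation GF := (freeGLie_grading K).

Definition lie_ideal (L : lieType K) (J : set L) : Prop :=
  [/\ J 0,
      forall a b, J a -> J b -> J (a + b),
      forall (k : K) a, J a -> J (k *: a) &
      forall a b, J a -> J (lie a b)].

Definition T_ideal (J : set F) : Prop :=
  lie_ideal J /\
  forall phi : {linear F -> F}, graded_hom GF GF phi ->
    forall a, J a -> J (phi a).

Definition T_ideal_gen (S : set F) : set F :=
  \bigcap_(I in [set I : set F | T_ideal I /\ S `<=` I]) I.

Definition fg_T_ideal (J : set F) : Prop :=
  exists2 S : set F, finite_set S & J = T_ideal_gen S.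

Definition graded_identities (L : lieType K) (GL : grading L) : set F :=
  [set a | forall phi : {linear F -> L}, graded_hom GF GL phi -> phi a = 0].

Lemma T_ideal_genP (S : set F) : T_ideal (T_ideal_gen S).
Proof.
split; first split.
- by move=> I [[[]]].
- by move=> a b Ja Jb I hI; have [[[_ ID _ _] _] _] := hI; apply: ID; [apply: Ja|apply: Jb].
- by move=> k a Ja I hI; have [[[_ _ IZ _] _] _] := hI; apply: IZ; apply: Ja.
- by move=> a b Ja I hI; have [[[_ _ _ IB] _] _] := hI; apply: IB; apply: Ja.
- move=> phi hphi a Ja I hI; have [[_ Iphi] _] := hI.
  by apply: Iphi => //; apply: Ja.
Qed.

Lemma graded_identities_T_ideal (L : lieType K) (GL : grading L) :
  T_ideal (graded_identities GL).
Proof.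
split; first split.
- by move=> phi _; rewrite linear0.
- by move=> a b ha hb phi hphi; rewrite linearD ha // hb // addr0.
- by move=> k a ha phi hphi; rewrite linearZ ha //= scaler0.
- by move=> a b ha phi hphi; rewrite (proj1 hphi) ha // lie0l.
- move=> psi [psiB psiG] a ha phi [phiB phiG].
  apply: (ha (phi \o psi)%FUN); split=> [b c|g b /psiG/phiG //].
  by rewrite /= psiB phiB.
Qed.

End TIdeals.

Section UT3.
Variable K : fieldType.

(* is_trig_mx tests lower triangularity. *)
Definition is_upper (A : 'M[K]_3) : bool := is_trig_mx A^T.

Lemma is_upperP (A : 'M[K]_3) :
  reflect (forall i j : 'I_3, (j < i)%N -> A i j = 0) (is_upper A).
Proof.
apply: (iffP is_trig_mxP) => hA i j /hA; first by rewrite mxE.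
by rewrite mxE.
Qed.

Record UT3 := MkUT3 { UT3val :> 'M[K]_3; _ : is_upper UT3val }.

HB.instance Definition _ := [isSub for UT3val].
HB.instance Definition _ := [Choice of UT3 by <:].

Lemma is_upper_closed : GRing.subsemimod_closed is_upper.
Proof.
split; first split.
- by apply/is_upperP => i j _; rewrite mxE.
- move=> A B /is_upperP hA /is_upperP hB; apply/is_upperP => i j ij.
  by rewrite mxE hA // hB // addr0.
- move=> k A /is_upperP hA; apply/is_upperP => i j ij.
  by rewrite mxE hA // mulr0.
Qed.

HB.instance Definition _ :=
  GRing.SubChoice_isSubLmodule.Build K 'M[K]_3 is_upper UT3 is_upper_closed.

Lemma is_upper_mul (A B : 'M[K]_3) :
  is_upper A -> is_upper B -> is_upper (A *m B).
Proof.
move=> /is_upperP hA /is_upperP hB; apply/is_upperP => i j ji.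
rewrite mxE big1 // => l _; case: (ltnP l i) => [/hA ->|il].
  by rewrite mul0r.
by rewrite hB ?mulr0 //; apply: leq_trans il.
Qed.

Lemma is_upper_comm (A B : UT3) :
  is_upper (UT3val A *m UT3val B - UT3val B *m UT3val A).
Proof.
case: A B => [A hA] [B hB] /=; apply/is_upperP => i j ji.
move/is_upperP: (is_upper_mul hA hB) => hAB.
move/is_upperP: (is_upper_mul hB hA) => hBA.
by rewrite mxE [X in _ + X]mxE hAB // hBA // subr0.
Qed.

Definition UT3_lie (A B : UT3) : UT3 := MkUT3 (is_upper_comm A B).

Lemma UT3valD (A B : UT3) : UT3val (A + B) = UT3val A + UT3val B.
Proof. by []. Qed.

Lemma UT3valZ k (A : UT3) : UT3val (k *: A) = k *: UT3val A.
Proof. by []. Qed.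

Lemma UT3_lie_linearl B : linear (UT3_lie^~ B).
Proof.
move=> k A C; apply: val_inj => /=.
by rewrite mulmxDl mulmxDr -scalemxAl -scalemxAr scalerBr opprD addrACA.
Qed.

Lemma UT3_lie_linearr A : linear (UT3_lie A).
Proof.
move=> k B C; apply: val_inj => /=.
by rewrite mulmxDl mulmxDr -scalemxAl -scalemxAr scalerBr opprD addrACA.
Qed.

Lemma UT3_liexx A : UT3_lie A A = 0.
Proof. by apply: val_inj; rewrite /= subrr. Qed.

Lemma UT3_lie_jacobi A B C :
  UT3_lie A (UT3_lie B C) + UT3_lie B (UT3_lie C A) + UT3_lie C (UT3_lie A B)
  = 0.
Proof.
apply: val_inj => /=.
rewrite !(mulmxBl, mulmxBr) !mulmxA !opprB !addrA.
rewrite [LHS](ACl ((1*12)*(7*2)*(3*10)*(5*4)*(11*6)*(9*8)))/=.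
by rewrite !subrr !addr0.
Qed.

HB.instance Definition _ := Lmodule_isLie.Build K UT3
  UT3_lie_linearl UT3_lie_linearr UT3_liexx UT3_lie_jacobi.

Lemma UT3val_lie (A B : UT3) :
  UT3val (lie A B) = UT3val A *m UT3val B - UT3val B *m UT3val A.
Proof. by []. Qed.

(* With rows and columns numbered from 0, deg e_ij = (j - i) mod 2 for i <= j;
   see unit_deg_table for the values. *)
Definition unit_deg (i j : 'I_3) : 'Z_2 := (j - i)%N%:R.

Lemma unit_deg_table :
  [/\ forall i, unit_deg i i = 0, unit_deg 0 2%:R = 0,
      unit_deg 0 1 = 1 & unit_deg 1 2%:R = 1].
Proof. by split=> [i|||]; rewrite /unit_deg ?subnn //; apply/val_inj. Qed.

(* The span of the e_ij of degree g, see Gamma11_compP. *)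
Definition Gamma11_comp (g : 'Z_2) : set UT3 :=
  [set A | forall i j : 'I_3, (i <= j)%N -> unit_deg i j != g ->
     UT3val A i j = 0].

Lemma Gamma11_compP g (A : UT3) :
  Gamma11_comp g A <->
  exists c : 'I_3 -> 'I_3 -> K, UT3val A =
    \sum_(i < 3) \sum_(j < 3 | (i <= j)%N && (unit_deg i j == g))
       c i j *: delta_mx i j.
Proof.
split=> [hA|[c cA] i j ij gij]; last first.
  rewrite cA summxE big1 // => k _; rewrite summxE big1 // => l /andP[_ gkl].
  rewrite !mxE; case: eqP => [ik|]; last by rewrite mulr0.
  case: eqP => [jl|]; last by rewrite mulr0.
  by move: gij; rewrite ik jl gkl.
exists (UT3val A); rewrite [LHS]matrix_sum_delta; apply: eq_bigr => i _.
rewrite [RHS]big_mkcond /=; apply: eq_bigr => j _.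
case: ifP => // /negbT; rewrite negb_and -ltnNge => /orP[ji|gij].
  by move/is_upperP: (valP A) => -> //; rewrite scale0r.
case: (leqP i j) => [ij|ji]; first by rewrite hA // scale0r.
by move/is_upperP: (valP A) => -> //; rewrite scale0r.
Qed.

Lemma Gamma11_0 g : Gamma11_comp g 0.
Proof. by move=> i j _ _; rewrite mxE. Qed.

Lemma Gamma11_D g A B :
  Gamma11_comp g A -> Gamma11_comp g B -> Gamma11_comp g (A + B).
Proof. by move=> hA hB i j ij gij; rewrite UT3valD mxE hA // hB // addr0. Qed.

Lemma Gamma11_Z g k A : Gamma11_comp g A -> Gamma11_comp g (k *: A).
Proof. by move=> hA i j ij gij; rewrite UT3valZ mxE hA // mulr0. Qed.

Definition Gamma11_part (g : 'Z_2) (A : UT3) : 'M[K]_3 :=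
  \matrix_(i, j) (if unit_deg i j == g then UT3val A i j else 0).

Lemma Gamma11_part_upper g A : is_upper (Gamma11_part g A).
Proof.
apply/is_upperP => i j ji; rewrite mxE; case: ifP => // _.
by move/is_upperP: (valP A) => ->.
Qed.

Lemma Gamma11_span A : exists a0 a1,
  [/\ Gamma11_comp 0 a0, Gamma11_comp 1 a1 & A = a0 + a1].
Proof.
exists (MkUT3 (Gamma11_part_upper 0 A)), (MkUT3 (Gamma11_part_upper 1 A)).
split=> [i j _ /= /negPf gij|i j _ /= /negPf gij|].
- by rewrite mxE gij.
- by rewrite mxE gij.
apply/val_inj/matrixP => i j; rewrite /= !mxE.
by case: (Z2P (unit_deg i j)) => ->; rewrite /= ?addr0 ?add0r.
Qed.

Lemma Gamma11_direct A : Gamma11_comp 0 A -> Gamma11_comp 1 A -> A = 0.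
Proof.
move=> A0 A1; apply/val_inj/matrixP => i j; rewrite /= [RHS]mxE.
case: (leqP i j) => [ij|ji]; last by move/is_upperP: (valP A) => ->.
by case: (Z2P (unit_deg i j)) => gij; [apply: A1|apply: A0]; rewrite // gij.
Qed.

Lemma unit_degD (i j l : 'I_3) : (i <= l)%N -> (l <= j)%N ->
  unit_deg i j = unit_deg i l + unit_deg l j.
Proof.
by move=> il lj; rewrite /unit_deg -natrD addnC addnBA // subnK.
Qed.

Lemma Gamma11_mul g h (A B : UT3) (i j : 'I_3) :
  Gamma11_comp g A -> Gamma11_comp h B -> unit_deg i j != g + h ->
  (UT3val A *m UT3val B) i j = 0.
Proof.
move=> hA hB gij; rewrite mxE big1 // => l _.
case: (leqP i l) => [il|li]; last first.
  by move/is_upperP: (valP A) => ->; rewrite ?mul0r.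
case: (leqP l j) => [lj|jl]; last first.
  by move/is_upperP: (valP B) => ->; rewrite ?mulr0.
case: (eqVneq (unit_deg i l) g) => [gil|gil]; last by rewrite hA ?mul0r.
case: (eqVneq (unit_deg l j) h) => [hlj|hlj]; last by rewrite hB ?mulr0.
by move: gij; rewrite (unit_degD il lj) gil hlj eqxx.
Qed.

Lemma Gamma11_lie g h A B :
  Gamma11_comp g A -> Gamma11_comp h B -> Gamma11_comp (g + h) (lie A B).
Proof.
move=> hA hB i j ij gij; rewrite UT3val_lie mxE [X in _ + X]mxE.
rewrite (Gamma11_mul hA hB gij) (Gamma11_mul hB hA) ?subr0 //.
by rewrite addrC.
Qed.

Definition Gamma11 : grading UT3 :=
  Grading Gamma11_0 Gamma11_D Gamma11_Z Gamma11_span Gamma11_direct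
    Gamma11_lie.

End UT3.

(* Main.v *)
Require Import Defs.
From mathcomp Require Import all_boot all_order all_algebra.
From mathcomp Require Import all_classical.

Set Implicit Arguments.
Unset Strict Implicit.
Unset Printing Implicit Defensive.

Import GRing.Theory.
Local Open Scope classical_set_scope.
Local Open Scope ring_scope.

(* Three identities of (UT_3, Gamma(1,1)) suffice: [y1,y2,z], [z1,z2,z3] and
   [[y1,y2],[y3,y4]]. Modulo the T-ideal I they generate, the free algebra is
   spanned by the y_i and the commutators [y_u,y_v,A], [z_u,A] and
   [[z_u,A],[z_v,B]], where A and B are multisets of y's; no linear
   independence is needed. Each of these families is indexed by multisets of
   naturals with marked elements, on which increasing renamings of the
   variables and multiplications by a y act by T-stable operators, so Higman's
   lemma and a leading-term reduction show that the part of a T-ideal lying in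
   one family is finitely generated modulo I. The substitutions z -> 0 and
   z -> -z separate the z-degrees (char <> 2), and polarisation reduces the
   z-quadratic part to its multilinear part (char <> 2 again). *)

(** * Well-quasi-orders: ascending subsequences, products and finite bases *)

Section WellQuasiOrder.

Definition wqo (T : Type) (R : T -> T -> Prop) :=
  forall f : nat -> T, exists i j, (i < j)%N /\ R (f i) (f j).

Lemma strict_iterate (g : nat -> nat) N :
  (forall n, (n < g n)%N) ->
  {homo (fun k => iter k g N) : i j / (i < j)%N}.
Proof. by move=> gP; apply: homo_ltn => [|k]; [apply: ltn_trans | apply: gP]. Qed.

(** Beyond some [N] every term lies below a later one, for otherwise the terms with no later upper
    bound would form a bad sequence. Iterating the choice of a later upper bound from [N] gives the
    subsequence. *)
Lemma wqo_ascending (T : Type) (R : T -> T -> Prop) (f : nat -> T) :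
  (forall x y z, R x y -> R y z -> R x z) -> wqo R ->
  exists2 phi : nat -> nat, {homo phi : i j / (i < j)%N} &
    forall i j, (i < j)%N -> R (f (phi i)) (f (phi j)).
Proof.
move=> Rtr Rwqo.
have [N NP] : exists N, forall n, (N <= n)%N ->
    exists m, (n < m)%N /\ R (f n) (f m).
  apply: contrapT => noN.
  have /choice[g gP] : forall N, exists n, (N < n)%N /\
      forall m, (n < m)%N -> ~ R (f n) (f m).
    move=> N; apply: contrapT => noN'; apply: noN; exists N.+1 => n Nn.
    apply: contrapT => nR; apply: noN'; exists n; split=> // m nm Rnm.
    by apply: nR; exists m.
  have gmono := strict_iterate 0%N (fun n => proj1 (gP n)).
  have [i [j [ij Rij]]] := Rwqo (fun k => f (iter k.+1 g 0%N)).
  have [_ /(_ (iter j.+1 g 0%N))] := gP (iter i g 0%N).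
  by apply=> //; apply: (gmono i.+1 j.+1).
have /choice[g gP] : forall n, exists m, (n < m)%N /\ ((N <= n)%N -> R (f n) (f m)).
  move=> n; case: (leqP N n) => [/NP[m [nm Rnm]]|_]; first by exists m.
  by exists n.+1.
have gmono := strict_iterate N (fun n => proj1 (gP n)).
exists (fun k => iter k g N) => // i j.
have step k : R (f (iter k g N)) (f (iter k.+1 g N)).
  apply: (proj2 (gP _)); elim: k => //= k IHk.
  by apply: leq_trans IHk (ltnW _); apply: (proj1 (gP _)).
elim: j => // j IHj; rewrite ltnS leq_eqVlt => /orP[/eqP ->|/IHj Rij].
  exact: step.
exact: Rtr Rij (step j).
Qed.

Lemma wqo_leq : wqo leq.
Proof.
move=> f; have [m [[i fi] mmin]] : exists m, (exists i, f i = m) /\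
    forall j, (m <= f j)%N.
  have exf : exists m, `[< exists i, f i = m >].
    by exists (f 0%N); apply/asboolP; exists 0%N.
  case: (ex_minnP exf) => m /asboolP fm mmin; exists m; split=> // j.
  by apply: mmin; apply/asboolP; exists j.
by exists i, i.+1; rewrite fi.
Qed.

Definition pair_rel (T U : Type) (R : T -> T -> Prop) (S : U -> U -> Prop)
  (x y : T * U) := R x.1 y.1 /\ S x.2 y.2.

Lemma wqo_pair (T U : Type) (R : T -> T -> Prop) (S : U -> U -> Prop) :
  (forall x y z, R x y -> R y z -> R x z) -> wqo R -> wqo S ->
  wqo (pair_rel R S).
Proof.
move=> Rtr Rwqo Swqo f.
have [phi phimono phiR] := wqo_ascending (fst \o f) Rtr Rwqo.
have [i [j [ij Sij]]] := Swqo (snd \o f \o phi).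
by exists (phi i), (phi j); split; [apply: phimono | split=> //; apply: phiR].
Qed.

(** If no finite set worked, one could keep adding elements of [P] that lie above none of those
    already chosen, and the additions would form a bad sequence. *)
Lemma wqo_finite_basis (T : Type) (R : T -> T -> Prop) (P : T -> Prop) :
  wqo R -> exists2 B : set T, finite_set B /\ B `<=` P &
    forall x, P x -> exists2 b, B b & R b x.
Proof.
move=> Rwqo; apply: contrapT => noB.
have noB' (B : set T) : finite_set B /\ B `<=` P ->
    exists x, P x /\ forall b, B b -> ~ R b x.
  move=> BP; apply: contrapT => nog; apply: noB; exists B => // x Px.
  apply: contrapT => nb; apply: nog; exists x; split=> // b Bb Rbx.
  by apply: nb; exists b.
have [x0 _] : exists x, P x /\ forall b, set0 b -> ~ R b x.
  by apply: noB'; split=> // x [].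
have /choice[g gP] : forall B : set T, exists x, finite_set B /\ B `<=` P ->
    P x /\ forall b, B b -> ~ R b x.
  move=> B; case: (pselect (finite_set B /\ B `<=` P)) => [/noB'[x xP]|nB].
    by exists x.
  by exists x0.
pose Bs := fun k => iter k (fun B => B `|` [set g B]) (set0 : set T).
have BsP k : finite_set (Bs k) /\ Bs k `<=` P.
  elim: k => [|k [finB BP]] /=; first by split=> // x [].
  split; first by rewrite finite_setU; split=> //; apply: finite_set1.
  by move=> x [/BP //|->]; apply: (proj1 (gP (Bs k) _)).
have Bs_g i j : (i < j)%N -> Bs j (g (Bs i)).
  elim: j => // j IHj; rewrite ltnS leq_eqVlt => /orP[/eqP -> |/IHj ?].
    by right.
  by left.
have [i [j [ij]]] := Rwqo (fun k => g (Bs k)).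
by have [_ /(_ _ (Bs_g _ _ ij))] := gP (Bs j) (BsP j).
Qed.

End WellQuasiOrder.

(** * Higman's lemma for words over a well-quasi-ordered alphabet *)

Section Higman.
Variables (T : Type) (R : T -> T -> Prop).

Inductive emb : seq T -> seq T -> Prop :=
| emb_nil w : emb [::] w
| emb_skip b s w : emb s w -> emb s (b :: w)
| emb_cons a b s w : R a b -> emb s w -> emb (a :: s) (b :: w).

(** The position map is made strictly increasing on all of [nat], not only below [size s], because
    it will serve as a renaming of all variables. *)
Lemma emb_strict s w : emb s w -> forall x0,
  exists2 p : nat -> nat, {homo p : i j / (i < j)%N} &
  forall i, (i < size s)%N -> (p i < size w)%N /\ R (nth x0 s i) (nth x0 w (p i)).
Proof.
move=> swE x0; elim: swE => {s w} [w|b s w _ [p pmono pP]|a b s w Rab _ [p pmono pP]].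
- by exists id.
- by exists (succn \o p) => [i j /pmono|i /pP].
- exists (fun i => if i is i'.+1 then (p i').+1 else 0%N).
    by case=> [|i] [|j] //; rewrite ltnS => /pmono.
  by case=> [|i] // /pP.
Qed.

(* Nash-Williams' minimal bad sequence argument. *)
Theorem higman : (forall x y z, R x y -> R y z -> R x z) -> wqo R -> wqo emb.
Proof.
move=> Rtr Rwqo f0; apply: contrapT => f0bad.
pose bad (f : nat -> seq T) := forall i j, (i < j)%N -> ~ emb (f i) (f j).
(* [ext p] means that [p] starts some bad sequence; [g] prolongs such a prefix by a shortest
   possible word. *)
pose ext p := exists f, bad f /\ forall i, (i < size p)%N -> f i = nth [::] p i.
have /choice[g gP] : forall p, exists x, ext p ->
    ext (rcons p x) /\ forall y, ext (rcons p y) -> (size x <= size y)%N.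
  move=> p; case: (pselect (ext p)) => [[f [fbad fp]]|]; last by exists [::].
  have exn : exists n, `[< exists2 x, ext (rcons p x) & size x = n >].
    exists (size (f (size p))); apply/asboolP; exists (f (size p)) => //.
    exists f; split=> // i; rewrite size_rcons ltnS nth_rcons leq_eqVlt.
    by case: ltngtP => [/fp //||->].
  case: (ex_minnP exn) => n /asboolP[x xext <-] xmin; exists x => _.
  by split=> // y yext; apply: xmin; apply/asboolP; exists y.
pose p n := iter n (fun p => rcons p (g p)) [::].
pose F n := g (p n).
have size_p n : size (p n) = n by elim: n => //= n IHn; rewrite size_rcons IHn.
have ext_p n : ext (p n).
  elim: n => [|n IHn] /=; last by apply: (proj1 (gP _ IHn)).
  exists f0; split=> // i j ij eij; apply: f0bad; by exists i, j.
have nth_p n i : (i < n)%N -> nth [::] (p n) i = F i.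
  elim: n => // n IHn; rewrite ltnS leq_eqVlt /= nth_rcons size_p.
  by case: ltngtP => // [/IHn|->].
have Fbad : bad F.
  move=> i j ij; have [f [fbad fE]] := ext_p j.+1.
  rewrite -(nth_p j.+1) ?ltnS ?(ltnW ij) // -(nth_p j.+1 j) //.
  rewrite -!fE ?size_p ?ltnS ?(ltnW ij) //; exact: fbad.
have Fmin h n : bad h -> (forall i, (i < n)%N -> h i = F i) ->
    (size (F n) <= size (h n))%N.
  move=> hbad hF; apply: (proj2 (gP _ (ext_p n))); exists h; split=> // i.
  rewrite size_rcons size_p ltnS nth_rcons size_p.
  by case: ltngtP => // [lt_in|->] _; rewrite // nth_p // hF.
have /choice[aw awP] : forall n, exists aw, F n = aw.1 :: aw.2.
  move=> n; case E: (F n) => [|a w]; last by exists (a, w).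
  by case: (Fbad n n.+1 (leqnn _)); rewrite E; apply: emb_nil.
have [phi phimono phiR] := wqo_ascending (fun n => (aw n).1) Rtr Rwqo.
(* Splice [F] before [phi 0] with the tails of the words [F (phi k)], whose heads ascend. The result
   is bad and has a shorter word at [phi 0], against minimality. *)
pose h i := if (i < phi 0)%N then F i else (aw (phi (i - phi 0)%N)).2.
have phi0 k : (phi 0 <= phi k)%N.
  by case: k => // k; apply: ltnW; apply: phimono.
suff hbad : bad h.
  have /(Fmin h (phi 0%N) hbad) : forall i, (i < phi 0)%N -> h i = F i.
    by move=> i; rewrite /h => ->.
  by rewrite /h ltnn subnn awP /= ltnn.
move=> i j ij; rewrite /h; case: (ltnP j (phi 0)) => jphi.
  by rewrite (ltn_trans ij jphi); apply: Fbad.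
case: (ltnP i (phi 0)) => iphi eij.
  apply: (Fbad i (phi (j - phi 0)%N)); first exact: leq_trans iphi (phi0 _).
  by rewrite [F (phi _)]awP; apply: emb_skip.
have ij' : (i - phi 0 < j - phi 0)%N by rewrite ltn_sub2rE.
apply: (Fbad _ _ (phimono _ _ ij')); rewrite !awP; apply: emb_cons => //.
exact: phiR.
Qed.

End Higman.

(** * A colexicographic order on finite multisets of naturals *)

Section CountOrder.
Implicit Types (s t r : seq nat) (p : nat -> nat).

Definition tail_count k s := count (leq k) s.

(* Colexicographic comparison of finite multisets of naturals: comparing the
   multiplicities from the top down amounts to comparing the tail counts. *)
Definition mset_lt s t := exists k,
  (tail_count k s < tail_count k t)%N /\
  forall j, (k < j)%N -> tail_count j s = tail_count j t.

Lemma tail_count_perm k s t : perm_eq s t -> tail_count k s = tail_count k t.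
Proof. by move=> /permP; apply. Qed.

Lemma tail_count_mem k s :
  tail_count k s = (count_mem k s + tail_count k.+1 s)%N.
Proof.
rewrite /tail_count; elim: s => //= x s ->.
rewrite addnACA; congr (_ + _)%N; rewrite eq_sym.
by case: ltngtP.
Qed.

Lemma eq_tail_count s t :
  (forall k, tail_count k s = tail_count k t) -> perm_eq s t.
Proof.
move=> st; apply/allP => x _ /=; apply/eqP/(@addIn (tail_count x.+1 s)).
by rewrite {2}st -!tail_count_mem.
Qed.

Lemma mset_lt_trans s t r : mset_lt s t -> mset_lt t r -> mset_lt s r.
Proof.
move=> [k [stk st]] [l [trl tr]]; case: (ltngtP k l) => [kl|lk|kl].
- by exists l; rewrite st //; split=> // j lj; rewrite st ?tr // (ltn_trans kl).
- by exists k; rewrite -tr //; split=> // j kj; rewrite st ?tr // (ltn_trans lk).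
- exists k; split=> [|j kj]; last by rewrite st ?tr // -kl.
  by apply: ltn_trans stk _; rewrite kl.
Qed.

Lemma mset_lt_permr s t t' : perm_eq t t' -> mset_lt s t -> mset_lt s t'.
Proof.
move=> tt' [k [stk st]]; exists k; rewrite -(tail_count_perm _ tt').
by split=> // j /st ->; apply: tail_count_perm.
Qed.

Lemma mset_lt_perml s s' t : perm_eq s s' -> mset_lt s t -> mset_lt s' t.
Proof.
move=> ss' [k [stk st]]; exists k; rewrite -(tail_count_perm _ ss').
by split=> // j /st <-; rewrite (tail_count_perm _ ss').
Qed.

(** Tail counts vanish above the sum of the entries, so two distinct multisets have a largest
    threshold at which their tail counts differ, and it decides the comparison. *)
Lemma mset_lt_total s t : [\/ mset_lt s t, perm_eq s t | mset_lt t s].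
Proof.
case: (pselect (forall k, tail_count k s = tail_count k t)) => [st|nst].
  by apply: Or32; apply: eq_tail_count.
have exk : exists k, tail_count k s != tail_count k t.
  apply: contrapT => no; apply: nst => k.
  by apply/eqP/negPn/negP => nk; apply: no; exists k.
have bnd k : tail_count k s != tail_count k t ->
    (k <= sumn s + sumn t)%N.
  have tail0 r : (sumn r < k)%N -> tail_count k r = 0%N.
    move=> rk; apply/eqP; rewrite -leqn0 leqNgt -has_count; apply/hasPn => x xr.
    rewrite -ltnNge; apply: leq_ltn_trans rk.
    elim: r xr => //= y r IHr; rewrite inE => /orP[/eqP ->|/IHr].
      exact: leq_addr.
    by move=> h; apply: leq_trans h (leq_addl _ _).
  rewrite leqNgt; apply: contra => stk; apply/eqP.
  by rewrite !tail0 // (leq_ltn_trans _ stk) ?leq_addl ?leq_addr.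
case: (ex_maxnP exk bnd) => k stk kmax.
have eqj j : (k < j)%N -> tail_count j s = tail_count j t.
  by move=> kj; apply/eqP/negPn/negP => /kmax; rewrite leqNgt kj.
case: (ltngtP (tail_count k s) (tail_count k t)) stk => // [lt|gt] _.
- by apply: Or31; exists k.
- by apply: Or33; exists k; split=> // j /eqj.
Qed.

Lemma strict_ge p k : {homo p : i j / (i < j)%N} -> (k <= p k)%N.
Proof.
move=> pmono; elim: k => // k IHk.
by apply: leq_ltn_trans IHk (pmono _ _ _).
Qed.

Lemma strict_leq p : {homo p : i j / (i < j)%N} -> {mono p : i j / (i <= j)%N}.
Proof. by move=> pmono; apply: leq_mono. Qed.

Lemma mset_lt_cons x s t : mset_lt s t -> mset_lt (x :: s) (x :: t).
Proof.
move=> [k [stk st]]; exists k; split; first by rewrite /tail_count /= ltn_add2l.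
by move=> j /st; rewrite /tail_count /= => ->.
Qed.

Lemma mset_lt_map p s t : {homo p : i j / (i < j)%N} ->
  mset_lt s t -> mset_lt (map p s) (map p t).
Proof.
move=> pmono [k [stk st]]; have ple := strict_leq pmono.
(* The preimage of an upper set under an increasing map is an upper set, so tail counts of an image
   are tail counts of the source. *)
have upset (j : nat) : exists l, forall x, (j <= p x)%N = (l <= x)%N.
  have exl : exists l, (j <= p l)%N by exists j; apply: strict_ge.
  case: (ex_minnP exl) => l jl lmin; exists l => x; apply/idP/idP => [/lmin //|lx].
  by apply: leq_trans jl _; rewrite ple.
have tail_map j l r : (forall x, (j <= p x)%N = (l <= x)%N) ->
    tail_count j (map p r) = tail_count l r.
  by move=> jl; rewrite /tail_count count_map; apply: eq_count => x /=.
exists (p k); split; first by rewrite !(tail_map (p k) k) // => x; rewrite ple.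
move=> j kj; have [l jl] := upset j; rewrite !(tail_map j l) //; apply: st.
by rewrite ltnNge -jl -ltnNge.
Qed.

(** Since [x <= p x], neither renaming nor adding entries can lower a tail count. *)
Lemma mset_lt_cat_map p s r : {homo p : i j / (i < j)%N} ->
  ~ mset_lt (map p s ++ r) s.
Proof.
move=> pmono [k [+ _]]; rewrite /tail_count count_cat count_map ltnNge => /negP; apply.
apply: leq_trans (leq_addr _ _); apply: sub_count => x kx /=.
by apply: leq_trans kx (strict_ge x pmono).
Qed.

End CountOrder.

(* An index pattern: two multisets [mA], [mB] of indices and two marked indices
   [mu], [mv]; it names one of the spanning commutators of the degree at hand. *)
Record pattern := Pattern {
  mA : seq nat; mB : seq nat; mu : nat; mv : nat }.

(** * Order and divisibility of patterns *)

Section Patterns.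
Implicit Types (m n : pattern) (p : nat -> nat).

Definition map_pattern p m :=
  Pattern (map p (mA m)) (map p (mB m)) (p (mu m)) (p (mv m)).

Definition consA k m := Pattern (k :: mA m) (mB m) (mu m) (mv m).
Definition consB k m := Pattern (mA m) (k :: mB m) (mu m) (mv m).

Definition pattern_perm m n :=
  [/\ perm_eq (mA m) (mA n), perm_eq (mB m) (mB n), mu m = mu n & mv m = mv n].

(** The divisibility that T-stable operators can realise: an increasing renaming of indices, then
    multiplication by y's in either multiset. *)
Definition pattern_dvd m n := exists p A B, {homo p : i j / (i < j)%N} /\
  pattern_perm n (Pattern (A ++ map p (mA m)) (B ++ map p (mB m)) (p (mu m)) (p (mv m))).

(** Residues modulo 4 record the role of an index and quotients its value, so one multiset holds the
    whole pattern and the order on multisets applies. *)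
Definition code m : seq nat :=
  [:: (mu m) * 4 + 2, (mv m) * 4 + 3 &
    [seq i * 4 | i <- mA m] ++ [seq i * 4 + 1 | i <- mB m]]%N.

Definition pattern_lt m n := mset_lt (code m) (code n).

Lemma code_perm m n : pattern_perm m n <-> perm_eq (code m) (code n).
Proof.
split=> [[AA BB uu vv]|mn].
  rewrite /code uu vv !perm_cons.
  exact: perm_cat (perm_map _ AA) (perm_map _ BB).
(* [dec c] reads back the field coded by the residue [c]. *)
pose dec (c : nat) s := [seq (i %/ 4)%N | i <- s & (i %% 4 == c)%N].
have decP c : perm_eq (dec c (code m)) (dec c (code n)).
  exact: perm_map (perm_filter _ mn).
have modE (r c i : nat) : (c < 4)%N -> ((i * 4 + c) %% 4 == r)%N = (c == r).
  by move=> c4; rewrite modnMDl modn_small.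
have divE c i : (c < 4)%N -> ((i * 4 + c) %/ 4)%N = i.
  by move=> c4; rewrite divnMDl // divn_small ?addn0.
have dec_map r c t : (c < 4)%N ->
    dec r [seq (i * 4 + c)%N | i <- t] = if c == r then t else [::].
  move=> c4; rewrite /dec filter_map -map_comp.
  rewrite (eq_filter (a2 := fun=> c == r)); last by move=> i /=; rewrite modE.
  case: (c == r); rewrite ?filter_predT ?filter_pred0 //.
  by rewrite (eq_map (g := id)) ?map_id // => i /=; rewrite divE.
have dec_cat r s t : dec r (s ++ t) = dec r s ++ dec r t.
  by rewrite /dec filter_cat map_cat.
have decE r m' : dec r (code m') = (if r == 2%N then [:: mu m'] else [::]) ++
    (if r == 3%N then [:: mv m'] else [::]) ++
    (if r == 0%N then mA m' else [::]) ++ (if r == 1%N then mB m' else [::]).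
  have -> : code m' = [seq (i * 4 + 2)%N | i <- [:: mu m']] ++
      [seq (i * 4 + 3)%N | i <- [:: mv m']] ++
      [seq (i * 4 + 0)%N | i <- mA m'] ++ [seq (i * 4 + 1)%N | i <- mB m'].
    by congr [:: _, _ & _ ++ _]; apply: eq_map => i; rewrite addn0.
  by rewrite !dec_cat !dec_map // ![_ == r]eq_sym.
have := (decP 0%N, decP 1%N, decP 2%N, decP 3%N); rewrite !decE /= !cats0.
move=> [[[AA BB] /perm_mem/(_ (mu m)) uu] /perm_mem/(_ (mv m)) vv].
by split=> //; apply/eqP; rewrite -mem_seq1 -?uu -?vv mem_head.
Qed.

Lemma pattern_lt_trans m n q : pattern_lt m n -> pattern_lt n q -> pattern_lt m q.
Proof. exact: mset_lt_trans. Qed.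

Lemma pattern_lt_total m n :
  [\/ pattern_lt m n, pattern_perm m n | pattern_lt n m].
Proof.
case: (mset_lt_total (code m) (code n)) => mn; [exact: Or31| |exact: Or33].
by apply: Or32; apply/code_perm.
Qed.

Lemma pattern_lt_permr m n n' : pattern_perm n n' -> pattern_lt m n -> pattern_lt m n'.
Proof. by move/code_perm; apply: mset_lt_permr. Qed.

Lemma code_map p : {homo p : i j / (i < j)%N} ->
  exists2 q : nat -> nat, {homo q : i j / (i < j)%N} &
    forall m, code (map_pattern p m) = map q (code m).
Proof.
move=> pmono.
pose q i := (p (i %/ 4) * 4 + i %% 4)%N.
have qE i c : (c < 4)%N -> q (i * 4 + c)%N = (p i * 4 + c)%N.
  by move=> c4; rewrite /q divnMDl // divn_small // addn0 modnMDl modn_small.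
have q0E i : q (i * 4)%N = (p i * 4)%N by rewrite -[(i * 4)%N]addn0 qE // addn0.
exists q => [i j ij|m'].
  rewrite /q; case: (ltngtP (i %/ 4) (j %/ 4)) => [lt|gt|eq].
  - apply: (@leq_trans ((p (i %/ 4)%N).+1 * 4)%N); last first.
      by apply: leq_trans (leq_addr _ _); rewrite leq_mul2r pmono ?orbT.
    by rewrite mulSn addnC ltn_add2r ltn_mod.
  - by have := leq_div2r 4 (ltnW ij); rewrite leqNgt gt.
  - rewrite eq ltn_add2l; move: ij.
    by rewrite {1}(divn_eq i 4) {1}(divn_eq j 4) eq ltn_add2l.
rewrite /code /= !qE // map_cat -!map_comp; do 2 congr (_ :: _).
by congr (_ ++ _); apply: eq_map => i /=; rewrite ?q0E ?qE.
Qed.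

Lemma pattern_lt_map p m n : {homo p : i j / (i < j)%N} ->
  pattern_lt m n -> pattern_lt (map_pattern p m) (map_pattern p n).
Proof.
move=> /code_map[q qmono codeE]; rewrite /pattern_lt !codeE.
exact: mset_lt_map.
Qed.

Lemma pattern_lt_consA k m n : pattern_lt m n -> pattern_lt (consA k m) (consA k n).
Proof.
move=> /(mset_lt_cons (k * 4)%N).
have E m' : perm_eq ((k * 4)%N :: code m') (code (consA k m')).
  by apply/permPl; exact: (perm_catCA [:: (k * 4)%N] [:: _; _] _).
by move=> mn; apply: mset_lt_permr (E n) _; apply: mset_lt_perml (E m) _.
Qed.

Lemma pattern_lt_consB k m n : pattern_lt m n -> pattern_lt (consB k m) (consB k n).
Proof.
move=> /(mset_lt_cons (k * 4 + 1)%N).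
have E m' : perm_eq ((k * 4 + 1)%N :: code m') (code (consB k m')).
  apply/permPl.
  exact: (perm_catCA [:: (k * 4 + 1)%N] [:: _, _ & [seq (i * 4)%N | i <- mA m']] _).
by move=> mn; apply: mset_lt_permr (E n) _; apply: mset_lt_perml (E m) _.
Qed.

(** Up to order, the code of a multiple is an increasing image of the code of [m] with entries
    added, which cannot be smaller. *)
Lemma pattern_lt_dvd m n : pattern_dvd m n -> ~ pattern_lt n m.
Proof.
move=> [p [A [B [pmono /code_perm mn]]]].
have [q qmono codeE] := code_map pmono.
pose r := [seq (i * 4)%N | i <- A] ++ [seq (i * 4 + 1)%N | i <- B].
have nE : perm_eq (code n) (map q (code m) ++ r).
  apply: perm_trans mn _; rewrite -codeE /r /code /= !map_cat !perm_cons.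
  by rewrite perm_catACA perm_catC.
move=> nm; apply: (@mset_lt_cat_map q (code m) r qmono).
exact: mset_lt_perml nE nm.
Qed.

(** A pattern becomes a word whose letter at [i] holds the two multiplicities of [i] and two bits
    telling whether [i] is marked. By Higman's lemma some word embeds in a later one; the embedding
    gives the renaming, the surplus multiplicities give [A] and [B]. *)
Lemma pattern_dvd_wqo : wqo pattern_dvd.
Proof.
pose letter := (nat * nat * nat * nat)%type.
pose R : letter -> letter -> Prop :=
  pair_rel (pair_rel (pair_rel leq leq) leq) leq.
have leqtr (x y z : nat) : (x <= y)%N -> (y <= z)%N -> (x <= z)%N by apply: leq_trans.
have pairtr (T U : Type) (S : T -> T -> Prop) (S' : U -> U -> Prop) :
    (forall x y z, S x y -> S y z -> S x z) ->
    (forall x y z, S' x y -> S' y z -> S' x z) ->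
    forall x y z, pair_rel S S' x y -> pair_rel S S' y z -> pair_rel S S' x z.
  by move=> Str S'tr x y z [? ?] [? ?]; split; [apply: Str|apply: S'tr]; eassumption.
have tr2 := pairtr _ _ leq leq leqtr leqtr.
have tr3 := pairtr _ _ _ leq tr2 leqtr.
have Rtr := pairtr _ _ _ leq tr3 leqtr.
have Rwqo : wqo R.
  apply: wqo_pair tr3 _ wqo_leq; apply: wqo_pair tr2 _ wqo_leq.
  exact: wqo_pair leqtr wqo_leq wqo_leq.
(* One more than the largest index in use, so that every index of [m] has its letter. *)
pose len m := (maxn (maxn (\max_(i <- mA m) i) (\max_(i <- mB m) i))
  (maxn (mu m) (mv m))).+1.
pose let_ m i : letter := (count_mem i (mA m), count_mem i (mB m),
  nat_of_bool (mu m == i), nat_of_bool (mv m == i)).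
move=> f.
have [i [j [ij eij]]] := @higman _ R Rtr Rwqo (fun k => mkseq (let_ (f k)) (len (f k))).
exists i, j; split=> //; move: (f i) (f j) eij => m n {f i j ij}.
case/emb_strict/(_ (0, 0, 0, 0)%N) => p pmono; rewrite size_mkseq => pP.
have {}pP x : (x < len m)%N -> R (let_ m x) (let_ n (p x)).
  by move=> xm; have [+ +] := pP x xm; rewrite size_mkseq => pn; rewrite !nth_mkseq.
have pinj : injective p by apply: incn_inj; apply: strict_leq.
have extra s t : (forall x, x \in s ->
      (x < len m)%N /\ (count_mem x s <= count_mem (p x) t)%N) ->
    exists r, perm_eq t (r ++ map p s).
  move=> st; have /count_subseqP[t' /perm_to_subseq[r tr] pt] :
      forall x, (count_mem x (map p s) <= count_mem x t)%N.
    move=> x; case: (boolP (x \in map p s)) => [/mapP[y ys ->]|/count_memPn -> //].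
    rewrite count_map; apply: leq_trans (proj2 (st y ys)).
    by apply: sub_count => z /=; rewrite inj_eq.
  exists r; rewrite (perm_trans tr) // perm_catC perm_cat2l perm_sym.
  exact: pt.
have lenA x : x \in mA m -> (x < len m)%N.
  by move=> xA; rewrite ltnS !leq_max (leq_bigmax_seq x xA (erefl true)).
have lenB x : x \in mB m -> (x < len m)%N.
  by move=> xB; rewrite ltnS !leq_max (leq_bigmax_seq x xB (erefl true)) ?orbT.
have [A EA] : exists A, perm_eq (mA n) (A ++ map p (mA m)).
  by apply: extra => x /lenA xm; split=> //; case: (pP x xm) => [[[]]].
have [B EB] : exists B, perm_eq (mB n) (B ++ map p (mB m)).
  by apply: extra => x /lenB xm; split=> //; case: (pP x xm) => [[[]]].
exists p, A, B; split=> //; split=> //=.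
(* A marked index has a component 1 in its letter, which only the bit of a marked index can
   dominate. *)
- have um : (mu m < len m)%N by rewrite ltnS !leq_max leqnn ?orbT.
  by have [[_ /=]] := pP _ um; rewrite eqxx lt0b => /eqP.
- have vm : (mv m < len m)%N by rewrite ltnS !leq_max leqnn ?orbT.
  by have [_ /=] := pP _ vm; rewrite eqxx lt0b => /eqP.
Qed.

(* In an infinite descent some term would divide a later, smaller one. *)
Lemma pattern_lt_wf : well_founded pattern_lt.
Proof.
move=> m; apply: contrapT => nacc.
have /choice[g gP] : forall x, exists y, ~ Acc pattern_lt x ->
    pattern_lt y x /\ ~ Acc pattern_lt y.
  move=> x; case: (pselect (Acc pattern_lt x)) => [|nx]; first by exists x.
  apply: contrapT => ng; apply: nx; constructor=> y yx; apply: contrapT => ny.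
  by apply: ng; exists y.
have fP k : ~ Acc pattern_lt (iter k g m) by elim: k => //= k /gP[].
have desc i j : (i < j)%N -> pattern_lt (iter j g m) (iter i g m).
  elim: j => // j IHj; rewrite ltnS leq_eqVlt /= => /orP[/eqP ->|/IHj].
    exact: (proj1 (gP _ (fP j))).
  exact: pattern_lt_trans (proj1 (gP _ (fP j))).
have [i [j [ij]]] := pattern_dvd_wqo (fun k => iter k g m).
by move/pattern_lt_dvd; apply; apply: desc.
Qed.

End Patterns.

(** * Subspaces and linear spans *)

Section LinearSpan.
Variables (K : fieldType) (V : lmodType K).
Implicit Types (S U : set V) (a b : V).

Definition subspace U :=
  [/\ U 0, forall a b, U a -> U b -> U (a + b) & forall k a, U a -> U (k *: a)].

Lemma subspaceB U a b : subspace U -> U a -> U b -> U (a - b).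
Proof. by case=> _ UD UZ Ua Ub; apply: UD => //; rewrite -scaleN1r; apply: UZ. Qed.

Lemma subspace_sum U n (f : nat -> V) : subspace U ->
  (forall i, U (f i)) -> U (\sum_(i < n) f i).
Proof. by case=> U0 UD _ Uf; elim/big_ind: _ => // *; apply: UD. Qed.

Lemma subspace_diff U a b : subspace U -> U (a - b) -> U a <-> U b.
Proof.
move=> Us Uab; split=> [Ua|Ub]; last first.
  by rewrite -(subrK b a); case: Us => _ UD _; apply: UD.
by rewrite -[b](subKr a); apply: subspaceB.
Qed.

Inductive lin_span S : set V :=
| lin_span0 : lin_span S 0
| lin_span_gen a : S a -> lin_span S a
| lin_spanD a b : lin_span S a -> lin_span S b -> lin_span S (a + b)
| lin_spanZ k a : lin_span S a -> lin_span S (k *: a).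

Lemma lin_span_subspace S : subspace (lin_span S).
Proof. by split; [apply: lin_span0|apply: lin_spanD|apply: lin_spanZ]. Qed.

Lemma lin_span_min S U : subspace U -> S `<=` U -> lin_span S `<=` U.
Proof.
move=> [U0 UD UZ] SU a; elim=> {a} [//|a /SU //|a b _ Ua _ Ub|k a _ Ua].
  exact: UD.
exact: UZ.
Qed.

Lemma lin_spanS S S' : S `<=` S' -> lin_span S `<=` lin_span S'.
Proof.
move=> SS'; apply: lin_span_min; first exact: lin_span_subspace.
by move=> a /SS'; apply: lin_span_gen.
Qed.

Lemma lin_spanU S S' a : lin_span (S `|` S') a ->
  exists b c, [/\ lin_span S b, lin_span S' c & a = b + c].
Proof.
elim=> {a} [|a [Sa|Sa]|a b _ [a0 [a1 [? ? ->]]] _ [b0 [b1 [? ? ->]]]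
  |k a _ [a0 [a1 [? ? ->]]]].
- by exists 0, 0; rewrite addr0; split=> //; apply: lin_span0.
- by exists a, 0; rewrite addr0; split=> //; [apply: lin_span_gen|apply: lin_span0].
- by exists 0, a; rewrite add0r; split=> //; [apply: lin_span0|apply: lin_span_gen].
- exists (a0 + b0), (a1 + b1).
  by rewrite addrACA; split=> //; apply: lin_spanD.
- by exists (k *: a0), (k *: a1); rewrite scalerDr; split=> //; apply: lin_spanZ.
Qed.

Lemma linear_add (T : V -> V) : linear T -> forall a b, T (a + b) = T a + T b.
Proof. by move=> Tl a b; have := Tl 1 a b; rewrite !scale1r. Qed.

Lemma linear_zero (T : V -> V) : linear T -> T 0 = 0.
Proof. by move=> Tl; apply: (addIr (T 0)); rewrite -(linear_add Tl) !add0r. Qed.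

Lemma linear_scale (T : V -> V) : linear T -> forall k a, T (k *: a) = k *: T a.
Proof. by move=> Tl k a; have := Tl k a 0; rewrite (linear_zero Tl) !addr0. Qed.

Lemma preim_subspace (T : V -> V) U : linear T -> subspace U ->
  subspace (T @^-1` U).
Proof.
move=> Tl [U0 UD UZ]; split=> [|a b|k a] /=; rewrite ?(linear_zero Tl) //.
  by rewrite (linear_add Tl); apply: UD.
by rewrite (linear_scale Tl); apply: UZ.
Qed.

Lemma lin_span_cong (T T' : V -> V) S U : linear T -> linear T' -> subspace U ->
  (forall s, S s -> U (T s - T' s)) -> forall a, lin_span S a -> U (T a - T' a).
Proof.
move=> Tl T'l Us SU; apply: lin_span_min => //.
apply: (preim_subspace (T := fun a => T a - T' a)) => // k a b.
by rewrite Tl T'l opprD addrACA scalerBr.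
Qed.

End LinearSpan.

(** * Leading-term reduction in T-ideals *)

Section Groebner.
Variable K : fieldType.
Local Notation F := (freeGLie K).
Implicit Types (I J : set F) (T : F -> F) (e : pattern -> F).

(** Preservation of all T-ideals at once lets the same operator act on [J] and on any T-ideal
    compared with it. *)
Definition T_stable T :=
  linear T /\ forall I, T_ideal I -> forall a, I a -> I (T a).

Lemma T_ideal_subspace I : T_ideal I -> subspace I.
Proof. by case=> [[? ? ? _] _]. Qed.

Lemma T_stable_id : T_stable id.
Proof. by []. Qed.

Lemma T_stable_comp T T' : T_stable T -> T_stable T' -> T_stable (T \o T').
Proof.
move=> [Tl TI] [T'l T'I]; split=> [k a b|I II a Ia] /=; first by rewrite T'l Tl.
by apply: TI => //; apply: T'I.
Qed.

Record pattern_family I e : Prop := PatternFamily {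
  family_perm m n : pattern_perm m n -> I (e m - e n);
  family_map p : {homo p : i j / (i < j)%N} -> exists2 T, T_stable T &
    forall m, I (T (e m) - e (map_pattern p m));
  family_consA k : exists2 T, T_stable T & forall m, I (T (e m) - e (consA k m));
  family_consB k : exists2 T, T_stable T & forall m, I (T (e m) - e (consB k m))
}.

Variables (I : set F) (e : pattern -> F).
Hypotheses (I_T_ideal : T_ideal I) (eP : pattern_family I e).

Let Isub := T_ideal_subspace I_T_ideal.

Let cong_trans a b c : I (a - b) -> I (b - c) -> I (a - c).
Proof.
by case: Isub => _ ID _ ab bc; rewrite -(subrK b a) -addrA; apply: ID.
Qed.

(** Compatibility with leading terms: modulo [I], such a [T] takes an element with leading term
    [e m] to one with leading term [e n]. *)
Definition carries T m n := [/\ T_stable T, I (T (e m) - e n) &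
  forall m', pattern_lt m' m -> exists2 n', pattern_lt n' n & I (T (e m') - e n')].

Lemma carries_trans T T' m n q :
  carries T m n -> carries T' n q -> carries (T' \o T) m q.
Proof.
move=> [Ts Tmn Tlt] [T's T'nq T'lt].
have T'I a b : I (a - b) -> I (T' a - T' b).
  case: T's => T'l T'I /(T'I _ I_T_ideal); rewrite (linear_add T'l) -scaleN1r.
  by rewrite (linear_scale T'l) scaleN1r.
split=> [||m' /Tlt[n' n'n Tn']]; first exact: T_stable_comp.
  exact: cong_trans (T'I _ _ Tmn) T'nq.
have [q' q'q T'q'] := T'lt _ n'n; exists q' => //.
exact: cong_trans (T'I _ _ Tn') T'q'.
Qed.

(** Divisibility decomposes into a renaming and single multiplications, each realised by the family
    and strictly monotone for [pattern_lt]. *)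
Lemma carries_dvd m n : pattern_dvd m n -> exists T, carries T m n.
Proof.
move=> [p [A [B [pmono mn]]]].
have [T Tmap] : exists T, carries T m (map_pattern p m).
  have [T Ts Te] := family_map eP pmono; exists T; split=> // m' m'm.
  by exists (map_pattern p m') => //; apply: pattern_lt_map.
have [TA TAP] : exists T, carries T m
    (Pattern (A ++ map p (mA m)) (map p (mB m)) (p (mu m)) (p (mv m))).
  elim: A {mn} => [|k A [TA TAP]]; first by exists T.
  have [T' T's T'e] := family_consA eP k; exists (T' \o TA).
  apply: carries_trans TAP _; split=> // m' m'm.
  by exists (consA k m') => //; exact: (pattern_lt_consA k m'm).
have [TB TBP] : exists T, carries T m (Pattern
    (A ++ map p (mA m)) (B ++ map p (mB m)) (p (mu m)) (p (mv m))).
  elim: B {mn} => [|k B [TB TBP]]; first by exists TA.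
  have [T' T's T'e] := family_consB eP k; exists (T' \o TB).
  apply: carries_trans TBP _; split=> // m' m'm.
  by exists (consB k m') => //; exact: (pattern_lt_consB k m'm).
have nm : pattern_perm (Pattern
    (A ++ map p (mA m)) (B ++ map p (mB m)) (p (mu m)) (p (mv m))) n.
  by case: mn => /= ? ? ? ?; split; rewrite // perm_sym.
(* Composing with the identity absorbs the final reordering of the multisets. *)
exists TB; suff : carries (id \o TB) m n by [].
apply: carries_trans TBP _; split=> [||m' m'lt]; first exact: T_stable_id.
  exact: (family_perm eP).
exists m'; first exact: pattern_lt_permr nm m'lt.
by rewrite subrr; case: Isub.
Qed.

Let below (P : set pattern) := lin_span (I `|` e @` P).

(** Any expression of [a] in the family yields such an [n]. The [e n] may be linearly dependent, so
    [n] is not canonical, and [c] may be 0 after a cancellation. *)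
Lemma leading_pattern (P : set pattern) a : below P a ->
  I a \/ exists n c, P n /\ below (pattern_lt^~ n) (a - c *: e n).
Proof.
have Ibelow Q b : I b -> below Q b by move=> Ib; apply: lin_span_gen; left.
have bsubD Q b c : below Q b -> below Q c -> below Q (b + c) by apply: lin_spanD.
have bsubZ Q k b : below Q b -> below Q (k *: b) by apply: lin_spanZ.
have [I0 ID IZ] := Isub.
elim=> {a} [|a [Ia|[n Pn <-]]|a b _ IHa _ IHb|k a _ IHa].
- by left.
- by left.
- right; exists n, 1; split=> //; rewrite scale1r subrr; apply: lin_span0.
- case: IHa => [Ia|[n [c [Pn aP]]]]; case: IHb => [Ib|[m [d [Pm bP]]]].
  + by left; apply: ID.
  + by right; exists m, d; rewrite -addrA; split=> //; apply: bsubD => //; apply: Ibelow.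
  + right; exists n, c; rewrite addrAC; split=> //.
    by apply: bsubD => //; apply: Ibelow.
  + have mono q r x f : pattern_lt q r -> below (pattern_lt^~ q) (x - f *: e q) ->
        below (pattern_lt^~ r) x.
      move=> qr xP; rewrite -(subrK (f *: e q) x); apply: bsubD.
        apply: lin_spanS xP => y [Iy|[s sq <-]]; [by left|right].
        by exists s => //; apply: pattern_lt_trans qr.
      by apply: bsubZ; apply: lin_span_gen; right; exists q.
    right; case: (pattern_lt_total n m) => nm.
    * exists m, d; split=> //; rewrite -addrA.
      by apply: bsubD bP; apply: mono nm aP.
    * exists n, (c + d); split=> //.
      have -> : a + b - (c + d) *: e n =
          (a - c *: e n) + ((b - d *: e m) + d *: (e m - e n)).
        by rewrite scalerBr [X in _ = _ + X]addrA subrK scalerDl opprD addrACA.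
      apply: (bsubD) => //; apply: bsubD; last first.
        apply: Ibelow; apply: IZ; apply: (family_perm eP).
        by case: nm => ? ? ? ?; split; rewrite // perm_sym.
      apply: lin_spanS bP => y [Iy|[s sm <-]]; [by left|right].
      exists s => //; apply: pattern_lt_permr sm.
      by case: nm => ? ? ? ?; split; rewrite // perm_sym.
    * exists n, c; split=> //; rewrite addrAC; apply: bsubD => //.
      exact: mono nm bP.
- case: IHa => [Ia|[n [c [Pn aP]]]]; first by left; apply: IZ.
  by right; exists n, (k * c); rewrite -scalerA -scalerBr; split=> //; apply: bsubZ.
Qed.

(** [S] holds one element of [J] for each member of a finite basis of the leading patterns of [J];
    all of [J] in the span reduces to it by induction on the leading pattern. Quantifying over every
    [J'] allows the sets [S] of several families to be united. *)
Theorem pattern_family_noetherian J : T_ideal J -> I `<=` J ->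
  exists2 S : set F, finite_set S /\ S `<=` J &
    forall J', T_ideal J' -> I `<=` J' -> S `<=` J' ->
    forall a, lin_span (I `|` range e) a -> J a -> J' a.
Proof.
move=> JT IJ; have Jsub := T_ideal_subspace JT; have [J0 JD JZ] := Jsub.
pose lead m a := J a /\ below (pattern_lt^~ m) (a - e m).
have [B [Bfin BP] Bdvd] := wqo_finite_basis (fun m => exists a, lead m a) pattern_dvd_wqo.
have /choice[f fP] : forall m, exists a, B m -> lead m a.
  move=> m; case: (pselect (B m)) => [/BP[a ?]|]; last by exists 0.
  by exists a.
exists (f @` B); first by split=> [|_ [m /fP[? _] <-] //]; apply: finite_image.
move=> J' J'T IJ' SJ'; have [J'0 J'D J'Z] := T_ideal_subspace J'T.
have [I0 ID IZ] := Isub.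
suff main m : forall a c, J a -> below (pattern_lt^~ m) (a - c *: e m) -> J' a.
  by move=> a /leading_pattern[/IJ' //|[n [c [_ aP]]]] Ja; apply: main aP.
elim/(well_founded_ind pattern_lt_wf): m => m IHm.
have below_J' a : J a -> below (pattern_lt^~ m) a -> J' a.
  by move=> Ja /leading_pattern[/IJ' //|[n [c [nm aP]]]]; apply: IHm aP.
(* If [c] vanishes, [a] already lies below [m] and has a smaller leading pattern. *)
move=> a c Ja; have [->|c0] := eqVneq c 0.
  by rewrite scale0r subr0; apply: below_J'.
move=> aP.
have [b Bb /carries_dvd[T [[Tl TJ] Tbm Tlt]]] :
    exists2 b, B b & pattern_dvd b m.
  apply: Bdvd; exists (c^-1 *: a); split; first exact: JZ.
  by rewrite -[e m](scalerK c0) -scalerBr; apply: lin_spanZ.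
have [Jfb fb_lead] := fP b Bb.
have J'Tfb : J' (T (f b)) by apply: TJ => //; apply: SJ'; exists b.
(* Subtracting [c *: T (f b)] cancels the leading term, leaving an element of [J] below [m]. *)
rewrite -(subrK (c *: T (f b)) a); apply: J'D; last exact: J'Z.
apply: below_J'; first by apply: subspaceB => //; apply: JZ; apply: TJ.
have -> : a - c *: T (f b) = (a - c *: e m) -
    c *: (T (f b - e b) + (T (e b) - e m)).
  rewrite -[f b in LHS](subrK (e b)) [in LHS](linear_add Tl) addrA scalerBr.
  by rewrite opprB addrA subrK.
apply: subspaceB => //; first exact: lin_span_subspace.
apply: lin_spanZ; apply: lin_spanD; last by apply: lin_span_gen; left.
suff sub : below (pattern_lt^~ b) `<=` T @^-1` below (pattern_lt^~ m).
  exact: sub fb_lead.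
apply: lin_span_min.
  by apply: preim_subspace => //; apply: lin_span_subspace.
move=> x [Ix|[n nb <-]] /=; first by apply: lin_span_gen; left; apply: TJ.
have [n' n'm Tn'] := Tlt _ nb; rewrite -(subrK (e n') (T _)); apply: lin_spanD.
  by apply: lin_span_gen; left.
by apply: lin_span_gen; right; exists n'.
Qed.

End Groebner.

(** The Jacobi identity in the form that rewrites towards left-normed brackets. *)
Lemma lie_swap (K : fieldType) (L : lieType K) (a b c : L) :
  lie a (lie b c) = lie (lie a b) c - lie (lie a c) b.
Proof.
have /eqP := lie_jacobi a b c; rewrite -addrA addr_eq0 => /eqP ->.
rewrite [lie (lie a b) c]lieC [lie (lie a c) b]lieC [lie a c]lieC opprK.
by rewrite -[- lie c a]scaleN1r lieZr scaleN1r opprD addrC.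
Qed.

(** * Substitutions and left-normed commutators in the free graded algebra *)

Section SpanningCommutators.
Variable K : fieldType.
Local Notation F := (freeGLie K).
Local Notation GF := (freeGLie_grading K).
Implicit Types (I J : set F) (s t : seq nat) (a b c : F).

Definition yvar k : F := fvar K (YVar k).
Definition zvar k : F := fvar K (ZVar k).

Lemma yvar_deg k : GF 0 (yvar k).
Proof. exact: (free_comp_var K gvar_deg (YVar k)). Qed.

Lemma zvar_deg k : GF 1 (zvar k).
Proof. exact: (free_comp_var K gvar_deg (ZVar k)). Qed.

Definition subst (fy fz : nat -> F) : F -> F :=
  free_ext (fun x => match x with YVar i => fy i | ZVar i => fz i end).

Lemma subst_y fy fz i : subst fy fz (yvar i) = fy i.
Proof. exact: free_extE. Qed.

Lemma subst_z fy fz i : subst fy fz (zvar i) = fz i.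
Proof. exact: free_extE. Qed.

Lemma subst_lie fy fz a b :
  subst fy fz (lie a b) = lie (subst fy fz a) (subst fy fz b).
Proof. exact: free_ext_lie. Qed.

Lemma subst_linear fy fz : linear (subst fy fz).
Proof. exact: free_ext_linear. Qed.

Lemma subst_stable fy fz : (forall i, GF 0 (fy i)) -> (forall i, GF 1 (fz i)) ->
  T_stable (subst fy fz).
Proof.
move=> fyP fzP; split=> [|I [_ Iphi] a Ia]; first exact: subst_linear.
apply: (Iphi (free_ext _)) => //; apply: free_ext_graded.
by case=> i; [apply: fyP | apply: fzP].
Qed.

(** The left-normed commutator [[a, y_k1, ..., y_kn]] for [s = [:: k1; ...; kn]]. *)
Definition lieys a s : F := foldl (fun b k => lie b (yvar k)) a s.

Lemma lieys_linear s : linear (lieys^~ s).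
Proof.
move=> k a b; elim: s a b => //= x s IHs a b.
by rewrite /lieys /= -/(lieys _ _) lie_linearl IHs.
Qed.

Lemma lieys0 s : lieys 0 s = 0.
Proof. exact: linear_zero (lieys_linear s). Qed.

Lemma lieysN a s : lieys (- a) s = - lieys a s.
Proof. by rewrite -!scaleN1r (linear_scale (lieys_linear s)). Qed.

Lemma lieysD a b s : lieys (a + b) s = lieys a s + lieys b s.
Proof. exact: linear_add (lieys_linear s) a b. Qed.

Lemma lieys_rcons a s k : lieys a (rcons s k) = lie (lieys a s) (yvar k).
Proof. by rewrite /lieys -cats1 foldl_cat. Qed.

Lemma lieys_deg g a s : GF g a -> GF g (lieys a s).
Proof.
elim: s a => [//|k s IHs] a ga; apply: (IHs (lie a (yvar k))).
by have := component_lie ga (yvar_deg k); rewrite addr0.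
Qed.

Lemma subst_lieys fy fz p a s : (forall i, fy i = yvar (p i)) ->
  subst fy fz (lieys a s) = lieys (subst fy fz a) (map p s).
Proof.
move=> fyE; elim: s a => //= k s IHs a.
by rewrite [LHS]IHs subst_lie subst_y fyE.
Qed.

Lemma subst_lieys_id fz a s :
  subst yvar fz (lieys a s) = lieys (subst yvar fz a) s.
Proof. by rewrite (subst_lieys _ (p := id)) // map_id. Qed.

Lemma T_ideal_liel I a b : T_ideal I -> I a -> I (lie a b).
Proof. by move=> [[_ _ _ IB] _]; apply: IB. Qed.

Lemma T_ideal_lier I a b : T_ideal I -> I b -> I (lie a b).
Proof.
move=> IT Ib; rewrite lieC -scaleN1r; case: (T_ideal_subspace IT) => _ _; apply.
exact: T_ideal_liel.
Qed.

Lemma T_ideal_lieys I a s : T_ideal I -> I a -> I (lieys a s).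
Proof.
move=> IT; elim: s a => [//|k s IHs] a Ia; apply: (IHs (lie a (yvar k))).
exact: T_ideal_liel.
Qed.

Lemma lieys_diff a b s : lieys a s - lieys b s = lieys (a - b) s.
Proof. by rewrite lieysD lieysN. Qed.

Lemma lieDsub a a' b b' : lie a b - lie a' b' = lie (a - a') b + lie a' (b - b') :> F.
Proof.
by rewrite lieDl lieDr -scaleN1r lieZl -[- b']scaleN1r lieZr !scaleN1r addrA subrK.
Qed.

(** By Jacobi, exchanging neighbours costs a bracket [[b, [y_i, y_j]]]. The class [C] contains every
    initial part [b] that occurs, so this bracket lies in [I]. *)
Lemma lieys_perm I C a s t : T_ideal I ->
  (forall b k, C b -> C (lie b (yvar k))) ->
  (forall b i j, C b -> I (lie b (lie (yvar i) (yvar j)))) ->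
  C a -> perm_eq s t -> I (lieys a s - lieys a t).
Proof.
move=> IT Clie CI; have [I0 ID IZ] := T_ideal_subspace IT.
have bubble x r b : C b -> I (lie (lieys b r) (yvar x) - lieys (lie b (yvar x)) r).
  elim: r b => [|k r IHr] b Cb /=; first by rewrite subrr.
  rewrite -(subrK (lieys (lie (lie b (yvar k)) (yvar x)) r) (lie _ _)) -addrA.
  apply: ID; first by apply: IHr; apply: Clie.
  by rewrite lieys_diff -lie_swap; apply: T_ideal_lieys => //; apply: CI.
elim: s a t => [|x s IHs] a t Ca st.
  by move: st; rewrite perm_sym => /perm_nilP ->; rewrite subrr.
have xt : x \in t by rewrite -(perm_mem st) mem_head.
case/splitPr: xt st => t1 t2 st.
have {}st : perm_eq s (t1 ++ t2).
  by move: st; rewrite perm_sym -[x :: t2]cat1s perm_catCA /= perm_cons perm_sym.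
rewrite -(subrK (lieys (lie a (yvar x)) (t1 ++ t2)) (lieys a (x :: s))) -addrA.
apply: ID; first by apply: IHs => //; apply: Clie.
rewrite /lieys !foldl_cat -!/(lieys _ _) /= -/(lieys _ _) lieys_diff.
apply: T_ideal_lieys => //; rewrite -opprB -scaleN1r; apply: IZ.
exact: bubble.
Qed.

(** * The three identities and the commutators that span modulo them *)

Definition id_yyz : F := lie (lie (yvar 0) (yvar 1)) (zvar 0).
Definition id_zzz : F := lie (lie (zvar 0) (zvar 1)) (zvar 2).
Definition id_yyyy : F := lie (lie (yvar 0) (yvar 1)) (lie (yvar 2) (yvar 3)).

Definition y_comm m : F := lieys (lie (yvar (mu m)) (yvar (mv m))) (mA m).
Definition z_comm m : F := lieys (zvar (mu m)) (mA m).
Definition zz_comm m : F :=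
  lie (lieys (zvar (mu m)) (mA m)) (lieys (zvar (mv m)) (mB m)).
(* The two [z]'s are taken from disjoint sets of variables, so that a
   substitution can act on one of them and fix the other. *)
Definition zz_comm_polar m : F :=
  lie (lieys (zvar (mu m).*2) (mA m)) (lieys (zvar (mv m).*2.+1) (mB m)).

Variable I : set F.
Hypotheses (IT : T_ideal I) (Iyyz : I id_yyz) (Izzz : I id_zzz) (Iyyyy : I id_yyyy).

Let Isub := T_ideal_subspace IT.

Lemma yyz_ideal a b c : GF 0 a -> GF 0 b -> GF 1 c -> I (lie (lie a b) c).
Proof.
move=> ga gb gc.
have := proj2 (subst_stable (fy := fun i => if i == 0%N then a else b)
  (fz := fun=> c) _ _) I IT _ Iyyz.
rewrite !subst_lie !subst_y subst_z; apply=> // i.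
by case: ifP.
Qed.

Lemma zzz_ideal a b c : GF 1 a -> GF 1 b -> GF 1 c -> I (lie (lie a b) c).
Proof.
move=> ga gb gc.
(* The default of [nth] gives [c] to [z_2] and to all later z's, so every value has degree 1. *)
have := proj2 (subst_stable (fy := yvar) (fz := fun i => nth c [:: a; b] i)
  yvar_deg _) I IT _ Izzz.
rewrite !subst_lie !subst_z; apply=> // i.
by case: i => [|[|[|i]]].
Qed.

Lemma yyyy_ideal a b c d : GF 0 a -> GF 0 b -> GF 0 c -> GF 0 d ->
  I (lie (lie a b) (lie c d)).
Proof.
move=> ga gb gc gd.
have := proj2 (subst_stable (fy := fun i => nth d [:: a; b; c] i) (fz := zvar)
  _ zvar_deg) I IT _ Iyyyy.
rewrite !subst_lie !subst_y; apply=> // i.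
by case: i => [|[|[|[|i]]]].
Qed.

Lemma lieys_z_perm a s t : GF 1 a -> perm_eq s t -> I (lieys a s - lieys a t).
Proof.
apply: (@lieys_perm _ (GF 1)) => // [b k gb|b i j gb].
  by have := component_lie gb (yvar_deg k); rewrite addr0.
rewrite lieC -scaleN1r; case: Isub => _ _; apply.
by apply: yyz_ideal => //; apply: yvar_deg.
Qed.

(** The class fed to [lieys_perm] for the y-commutators: it is stable under bracketing with a y, and
    [yyyy_ideal] applies to its members. *)
Definition is_yy a := exists b c, [/\ GF 0 b, GF 0 c & a = lie b c].

Lemma is_yy_lie a k : is_yy a -> is_yy (lie a (yvar k)).
Proof.
move=> [b [c [gb gc ->]]]; exists (lie b c), (yvar k); split=> //.
  by have := component_lie gb gc; rewrite addr0.
exact: yvar_deg.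
Qed.

Lemma lieys_yy_perm a s t : is_yy a -> perm_eq s t -> I (lieys a s - lieys a t).
Proof.
apply: (@lieys_perm _ is_yy) => // [b k|b i j [c [d [gc gd ->]]]].
  exact: is_yy_lie.
by apply: yyyy_ideal => //; apply: yvar_deg.
Qed.

Lemma is_yy_y_comm m : is_yy (y_comm m).
Proof.
rewrite /y_comm; have : is_yy (lie (yvar (mu m)) (yvar (mv m))).
  by exists (yvar (mu m)), (yvar (mv m)); split=> //; apply: yvar_deg.
by elim: (mA m) (lie _ _) => //= k s IHs a /(is_yy_lie k)/IHs.
Qed.

Let I_refl a : I (a - a).
Proof. by rewrite subrr; case: Isub. Qed.

Lemma map_stable p q (T := subst (yvar \o p) (zvar \o q)) : T_stable T.
Proof. by apply: subst_stable => i /=; [apply: yvar_deg|apply: zvar_deg]. Qed.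

Lemma bracket_stable k : T_stable (fun a : F => lie a (yvar k)).
Proof.
split=> [c a b|J JT a]; first by rewrite lie_linearl.
exact: T_ideal_liel.
Qed.

Lemma liez_deg i k : GF 1 (lie (zvar i) (yvar k)).
Proof. by have := component_lie (zvar_deg i) (yvar_deg k); rewrite addr0. Qed.

(** * The commutators as pattern families *)

Lemma y_family : pattern_family I y_comm.
Proof.
split=> [m n [AA _ uu vv]|p _|k|k].
- rewrite /y_comm uu vv; apply: lieys_yy_perm => //.
  by exists (yvar (mu n)), (yvar (mv n)); split=> //; apply: yvar_deg.
- exists (subst (yvar \o p) (zvar \o p)) => [|m]; first exact: map_stable.
  by rewrite /y_comm (subst_lieys _ (p := p)) // subst_lie !subst_y; apply: I_refl.
- exists (fun a : F => lie a (yvar k)) => [|m]; first exact: bracket_stable.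
  rewrite /y_comm -lieys_rcons; apply: lieys_yy_perm; last by rewrite perm_rcons.
  by exists (yvar (mu m)), (yvar (mv m)); split=> //; apply: yvar_deg.
- by exists id => [|m]; [exact: T_stable_id | apply: I_refl].
Qed.

Lemma z_family : pattern_family I z_comm.
Proof.
split=> [m n [AA _ uu vv]|p _|k|k].
- by rewrite /z_comm uu; apply: lieys_z_perm => //; apply: zvar_deg.
- exists (subst (yvar \o p) (zvar \o p)) => [|m]; first exact: map_stable.
  by rewrite /z_comm (subst_lieys _ (p := p)) // subst_z; apply: I_refl.
- exists (subst yvar (fun i => lie (zvar i) (yvar k))) => [|m].
    by apply: subst_stable => i; [apply: yvar_deg|apply: liez_deg].
  by rewrite /z_comm subst_lieys_id subst_z; apply: I_refl.
- by exists id => [|m]; [exact: T_stable_id | apply: I_refl].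
Qed.

(** Bracketing with a y would act on both factors by the Leibniz rule. Even z's occur only on the
    left and odd ones only on the right, so substituting [[z_i, y_k]] for one parity lengthens a
    single factor. *)
Lemma zz_polar_family : pattern_family I zz_comm_polar.
Proof.
have [I0 ID IZ] := Isub.
split=> [m n [AA BB uu vv]|p _|k|k].
- rewrite /zz_comm_polar uu vv lieDsub; apply: ID.
    by apply: T_ideal_liel => //; apply: lieys_z_perm => //; apply: zvar_deg.
  by apply: T_ideal_lier => //; apply: lieys_z_perm => //; apply: zvar_deg.
(* [q] renames the half of an index and keeps its parity, so the two factors stay separated. *)
- pose q i := (odd i + (p i./2).*2)%N.
  have q0 i : q i.*2 = (p i).*2 by rewrite /q odd_double doubleK.
  have q1 i : q i.*2.+1 = (p i).*2.+1 by rewrite /q /= odd_double uphalf_double.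
  exists (subst (yvar \o p) (zvar \o q)) => [|m]; first exact: map_stable.
  rewrite /zz_comm_polar subst_lie !(subst_lieys _ (p := p)) // !subst_z /=.
  by rewrite q0 q1; apply: I_refl.
- exists (subst yvar (fun i => if odd i then zvar i else lie (zvar i) (yvar k))) => [|m].
    apply: subst_stable => i; first exact: yvar_deg.
    by case: ifP => _; [apply: zvar_deg|apply: liez_deg].
  rewrite /zz_comm_polar subst_lie !subst_lieys_id !subst_z /= !odd_double.
  exact: I_refl.
- exists (subst yvar (fun i => if odd i then lie (zvar i) (yvar k) else zvar i)) => [|m].
    apply: subst_stable => i; first exact: yvar_deg.
    by case: ifP => _; [apply: liez_deg|apply: zvar_deg].
  rewrite /zz_comm_polar subst_lie !subst_lieys_id !subst_z /= !odd_double.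
  exact: I_refl.
Qed.

(** * The commutators span modulo [I] *)

Definition span_y := lin_span (I `|` range yvar).
Definition span_yy := lin_span (I `|` range y_comm).
Definition span_z := lin_span (I `|` range z_comm).
Definition span_zz := lin_span (I `|` range zz_comm).

Definition spanning : set F :=
  (range yvar `|` range y_comm) `|` (range z_comm `|` range zz_comm).

Let W := lin_span (I `|` spanning).

(** Bracketing with a variable yields a combination of longer commutators of the four families,
    except that a z sends y-commutators and zz-commutators into [I] by [yyz_ideal] and
    [zzz_ideal]. *)
Lemma spanning_lie_var x a : W a -> W (lie a (fvar K x)).
Proof.
have WI b : I b -> W b by move=> Ib; apply: lin_span_gen; left.
have Wgen b : spanning b -> W b by move=> Ib; apply: lin_span_gen; right.
have WN b : W b -> W (- b) by rewrite -scaleN1r; apply: lin_spanZ.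
have Wsub : subspace W by apply: lin_span_subspace.
move: a; apply: lin_span_min.
  apply: (preim_subspace (T := fun a : F => lie a (fvar K x))) => // k a b.
  by rewrite lie_linearl.
move=> a [Ia|]; first by apply: WI; apply: T_ideal_liel.
case: x => k; rewrite -/(yvar k) -/(zvar k).
- move=> [[[i _ <-]|[m _ <-]]|[[m _ <-]|[m _ <-]]] /=.
  + by apply: Wgen; left; right; exists (Pattern [::] [::] i k).
  + apply: Wgen; left; right; exists (Pattern (rcons (mA m) k) [::] (mu m) (mv m)) => //.
    by rewrite /y_comm lieys_rcons.
  + apply: Wgen; right; left; exists (Pattern (rcons (mA m) k) [::] (mu m) (mv m)) => //.
    by rewrite /z_comm lieys_rcons.
  + rewrite /zz_comm; set b := lieys (zvar (mu m)) _; set c := lieys (zvar (mv m)) _.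
    have -> : lie (lie b c) (yvar k) = lie (lie b (yvar k)) c + lie b (lie c (yvar k)).
      by rewrite [lie b (lie c _)]lie_swap addrC subrK.
    apply: lin_spanD; apply: Wgen; right; right.
      exists (Pattern (rcons (mA m) k) (mB m) (mu m) (mv m)) => //.
      by rewrite /zz_comm lieys_rcons.
    exists (Pattern (mA m) (rcons (mB m) k) (mu m) (mv m)) => //.
    by rewrite /zz_comm lieys_rcons.
- move=> [[[i _ <-]|[m _ <-]]|[[m _ <-]|[m _ <-]]] /=.
  + rewrite lieC; apply: WN; apply: Wgen; right; left.
    by exists (Pattern [:: i] [::] k 0).
  + apply: WI; have [b [c [gb gc ->]]] := is_yy_y_comm m.
    by apply: yyz_ideal => //; apply: zvar_deg.
  + apply: Wgen; right; right.
    by exists (Pattern (mA m) [::] (mu m) k).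
  + by apply: WI; apply: zzz_ideal; do ?apply: lieys_deg; apply: zvar_deg.
Qed.

(** The induction also carries stability of [W] under bracketing with [a], which passes to a bracket
    of two elements by Jacobi. *)
Lemma spanningP a : W a.
Proof.
suff [] : W a /\ forall b, W b -> W (lie b a) by [].
have Wsub : subspace W by apply: lin_span_subspace.
elim/freeLie_ind: a => [x||a b [Wa aW] [Wb bW]|k a [Wa aW]|a b [Wa aW] [Wb bW]].
- split; last exact: spanning_lie_var.
  apply: lin_span_gen; right; case: x => i.
    by left; left; exists i.
  by right; left; exists (Pattern [::] [::] i 0).
- by split=> [|b _]; rewrite ?lie0r; apply: lin_span0.
- split=> [|c Wc]; first exact: lin_spanD.
  by rewrite lieDr; apply: lin_spanD; [apply: aW|apply: bW].
- split=> [|c Wc]; first exact: lin_spanZ.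
  by rewrite lieZr; apply: lin_spanZ; apply: aW.
- split=> [|c Wc]; first exact: bW.
  by rewrite lie_swap; apply: subspaceB => //; [apply/bW/aW|apply/aW/bW].
Qed.

Lemma spanning_decomposition a : exists l a0 a1 a2,
  [/\ span_y l, span_yy a0, span_z a1, span_zz a2 & a = l + a0 + (a1 + a2)].
Proof.
have sub (S S' : set F) : S `<=` S' -> lin_span S `<=` lin_span (I `|` S').
  by move=> SS'; apply: lin_spanS => x /SS'; right.
have := spanningP a; rewrite /W /spanning.
have -> : I `|` spanning =
    (I `|` range yvar `|` range y_comm) `|` (range z_comm `|` range zz_comm).
  by rewrite /spanning !setUA.
move=> /lin_spanU[b [c [/lin_spanU[l [a0 [yl y0 ->]]]
  /lin_spanU[a1 [a2 [z1 z2 ->]]] ->]]].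
by exists l, a0, a1, a2; split=> //; [apply: sub y0|apply: sub z1|apply: sub z2].
Qed.

Lemma span_family_cong (X : Type) (e : X -> F) (T T' : F -> F) :
  T_stable T -> T_stable T' -> (forall m, I (T (e m) - T' (e m))) ->
  forall a, lin_span (I `|` range e) a -> I (T a - T' a).
Proof.
move=> [Tl TI] [T'l T'I] eTT'; apply: lin_span_cong => // a [Ia|[m _ <-] //].
by apply: subspaceB => //; [apply: TI|apply: T'I].
Qed.

Lemma scale_stable k : T_stable (fun a : F => k *: a).
Proof.
split=> [c a b|J JT a]; first by rewrite scalerDr !scalerA mulrC.
by case: (T_ideal_subspace JT) => _ _; apply.
Qed.

(** * Separation of the degrees in the z's *)

Definition z_zero := subst yvar (fun=> 0).
Definition z_opp := subst yvar (fun i => - zvar i).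

Lemma z_zero_stable : T_stable z_zero.
Proof.
by apply: subst_stable => i; [apply: yvar_deg|apply: component0].
Qed.

Lemma z_opp_stable : T_stable z_opp.
Proof.
apply: subst_stable => i; first exact: yvar_deg.
by rewrite -scaleN1r; apply: componentZ; apply: zvar_deg.
Qed.

Lemma z_zero_decomposition l a0 a1 a2 :
  span_y l -> span_yy a0 -> span_z a1 -> span_zz a2 ->
  I (z_zero (l + a0 + (a1 + a2)) - (l + a0)).
Proof.
move=> yl y0 z1 z2; have [zl zI] := z_zero_stable.
have [I0 ID IZ] := Isub.
have fix_y : I (z_zero l - l).
  have := span_family_cong (e := yvar) z_zero_stable (T_stable_id K) _ yl; apply=> i.
  by rewrite /z_zero subst_y; apply: I_refl.
have fix_yy : I (z_zero a0 - a0).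
  have := span_family_cong (e := y_comm) z_zero_stable (T_stable_id K) _ y0; apply=> m.
  by rewrite /z_zero subst_lieys_id subst_lie !subst_y; apply: I_refl.
have kill_z : I (z_zero a1).
  move: a1 z1; apply: lin_span_min; first exact: preim_subspace.
  move=> a [/(zI _ IT) //|[m _ <-]] /=.
  by rewrite /z_zero subst_lieys_id subst_z lieys0.
have kill_zz : I (z_zero a2).
  move: a2 z2; apply: lin_span_min; first exact: preim_subspace.
  move=> a [/(zI _ IT) //|[m _ <-]] /=.
  by rewrite /z_zero subst_lie !subst_lieys_id subst_z lieys0 lie0l.
rewrite !(linear_add zl) [X in I X]addrAC opprD [X in I (X + _)]addrACA.
exact: ID (ID _ _ fix_y fix_yy) (ID _ _ kill_z kill_zz).
Qed.

Lemma z_opp_decomposition a1 a2 : span_z a1 -> span_zz a2 ->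
  I (z_opp (a1 + a2) - (a2 - a1)).
Proof.
move=> z1 z2; have [zl zI] := z_opp_stable.
have [I0 ID IZ] := Isub.
have opp_z : I (z_opp a1 - (-1) *: a1).
  have := span_family_cong (e := z_comm) z_opp_stable (scale_stable (-1)) _ z1; apply=> m.
  by rewrite /z_opp subst_lieys_id subst_z lieysN scaleN1r; apply: I_refl.
have fix_zz : I (z_opp a2 - a2).
  have := span_family_cong (e := zz_comm) z_opp_stable (T_stable_id K) _ z2; apply=> m.
  rewrite /z_opp subst_lie !subst_lieys_id !subst_z !lieysN -scaleN1r.
  rewrite -[- lieys _ (mB m)]scaleN1r lieZl lieZr scalerA mulrNN mulr1 scale1r.
  exact: I_refl.
rewrite (linear_add zl) [a2 - a1]addrC opprD addrACA.
by apply: ID => //; rewrite -[- a1]scaleN1r.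
Qed.

(** * The linear part in the y's, and polarisation of the quadratic part in the z's *)

Definition y_only (i : nat) := subst (fun j => if j == i then yvar i else 0) (fun=> 0).

Lemma y_only_stable i : T_stable (y_only i).
Proof.
apply: subst_stable => j; last exact: component0.
by case: ifP => _; [apply: yvar_deg|apply: component0].
Qed.

(** Both entries of the innermost bracket become [yvar i] or 0, so it vanishes. *)
Lemma y_only_yy i a : span_yy a -> I (y_only i a).
Proof.
have [yl yI] := y_only_stable i; have [I0 _ _] := Isub.
move: a; apply: lin_span_min; first exact: preim_subspace.
move=> a [/(yI _ IT) //|[m _ <-]] /=.
rewrite /y_comm; set b := lie _ _.
have : y_only i b = 0.
  rewrite /y_only subst_lie !subst_y.
  by case: ifP => _; case: ifP => _; rewrite ?lie0l ?lie0r ?liexx.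
elim: (mA m) b => //= [|k s IHs] b b0; first by rewrite b0.
by apply: IHs; rewrite /y_only subst_lie -/(y_only i) b0 lie0l.
Qed.

Lemma y_only_y i l : span_y l -> exists c : K, I (y_only i l - c *: yvar i).
Proof.
have [yl yI] := y_only_stable i; have [I0 ID IZ] := Isub.
elim=> {l} [|a [Ia|[j _ <-]]|a b _ [c ac] _ [d bd]|k a _ [c ac]].
- by exists 0; rewrite scale0r (linear_zero yl); apply: I_refl.
- by exists 0; rewrite scale0r subr0; apply: yI.
- exists (if j == i then 1 else 0); rewrite /y_only subst_y.
  by case: ifP => _; rewrite ?scale1r ?scale0r; apply: I_refl.
- by exists (c + d); rewrite (linear_add yl) scalerDl opprD addrACA; apply: ID.
- by exists (k * c); rewrite (linear_scale yl) -scalerA -scalerBr; apply: IZ.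
Qed.

(** Only finitely many y's occur. The claim covers all [n] beyond a bound so that the bounds of two
    summands combine into their maximum. *)
Lemma y_only_sum l : span_y l ->
  exists N, forall n, (N <= n)%N -> I (l - \sum_(i < n) y_only i l).
Proof.
have [I0 ID IZ] := Isub; have yl i := proj1 (y_only_stable i).
elim=> {l} [|a [Ia|[j _ <-]]|a b _ [N aN] _ [M bM]|k a _ [N aN]].
- exists 0%N => n _; rewrite big1 ?subrr // => i _; exact: linear_zero.
- exists 0%N => n _; apply: subspaceB => //.
  apply: (subspace_sum _ (f := fun i => y_only i a)) => // i.
  by apply: (proj2 (y_only_stable i)).
- exists j.+1 => n jn; rewrite (bigD1 (Ordinal jn)) //= /y_only subst_y eqxx.
  rewrite big1 ?addr0 // => i; rewrite subst_y -val_eqE /= eq_sym.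
  by move/negPf->.
- exists (maxn N M) => n; rewrite geq_max => /andP[/aN aI /bM bI].
  have -> : \sum_(i < n) y_only i (a + b) =
      \sum_(i < n) y_only i a + \sum_(i < n) y_only i b.
    by rewrite -big_split; apply: eq_bigr => i _; rewrite (linear_add (yl i)).
  by rewrite opprD addrACA; apply: ID.
- exists N => n /aN aI.
  have -> : \sum_(i < n) y_only i (k *: a) = k *: \sum_(i < n) y_only i a.
    by rewrite scaler_sumr; apply: eq_bigr => i _; rewrite (linear_scale (yl i)).
  by rewrite -scalerBr; apply: IZ.
Qed.

Lemma yvar_T_ideal J i j : T_ideal J -> J (yvar i) -> J (yvar j).
Proof.
move=> JT Ji; rewrite -(subst_y (fun=> yvar j) zvar i).
apply: (proj2 (subst_stable (fun=> yvar_deg j) zvar_deg)) => //.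
Qed.

(* A form quadratic in the [z]'s is half the diagonal restriction of its
   polarisation, hence generates the same T-ideal when char <> 2. *)
Definition z_split := subst yvar (fun i => zvar i.*2 + zvar i.*2.+1).
Definition z_even := subst yvar (fun i => zvar i.*2).
Definition z_odd := subst yvar (fun i => zvar i.*2.+1).
Definition z_merge := subst yvar (fun i => zvar i./2).
Definition polarise a := z_split a - z_even a - z_odd a.

Lemma polarise_stable : T_stable polarise.
Proof.
have ys := yvar_deg; have zs := zvar_deg.
have [] : [/\ T_stable z_split, T_stable z_even & T_stable z_odd].
  by split; apply: subst_stable => // i; apply: componentD.
move=> [sl sI] [el eI] [ol oI]; split=> [k a b|J JT a Ja].
  rewrite /polarise sl el ol !opprD !scalerBr.
  by rewrite [X in X + _ = _]addrACA [LHS]addrACA.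
have Js := T_ideal_subspace JT.
by do 2?apply: subspaceB => //; [apply: sI|apply: eI|apply: oI].
Qed.

(** The cross terms are [[a, b']] and [[a', b]]; anticommutativity puts the even z of the second one
    on the left, whence the sign and the exchanged fields. *)
Lemma polarise_zz m : polarise (zz_comm m) =
  zz_comm_polar m - zz_comm_polar (Pattern (mB m) (mA m) (mv m) (mu m)).
Proof.
rewrite /polarise /z_split /z_even /z_odd /zz_comm /zz_comm_polar /=.
rewrite !subst_lie !subst_lieys_id !subst_z !lieysD.
set a := lieys (zvar (mu m).*2) _; set a' := lieys (zvar (mu m).*2.+1) _.
set b := lieys (zvar (mv m).*2) _; set b' := lieys (zvar (mv m).*2.+1) _.
rewrite [lie b a']lieC opprK lieDl !lieDr.
by rewrite addrAC addrA addrK addrC -addrA addKr.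
Qed.

Lemma polarise_span a : span_zz a ->
  lin_span (I `|` range zz_comm_polar) (polarise a).
Proof.
have [pl pI] := polarise_stable.
have sS : subspace (lin_span (I `|` range zz_comm_polar)) by apply: lin_span_subspace.
move: a; apply: lin_span_min; first exact: preim_subspace.
move=> a [/(pI _ IT) Ia|[m _ <-]] /=; first by apply: lin_span_gen; left.
rewrite polarise_zz; apply: subspaceB => //; apply: lin_span_gen; right.
  by exists m.
by exists (Pattern (mB m) (mA m) (mv m) (mu m)).
Qed.

Lemma z_merge_stable : T_stable z_merge.
Proof. by apply: subst_stable => i; [apply: yvar_deg|apply: zvar_deg]. Qed.

Lemma merge_polarise a : span_zz a -> I (z_merge (polarise a) - 2%:R *: a).
Proof.
move=> za; have := span_family_cong (e := zz_comm)
  (T_stable_comp z_merge_stable polarise_stable) (scale_stable 2%:R) _ za.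
apply=> m.
have mE m' : z_merge (zz_comm_polar m') = zz_comm m'.
  rewrite /z_merge subst_lie !subst_lieys_id !subst_z doubleK.
  by rewrite -[_.*2.+1]add1n halfD /= odd_double add0n doubleK.
rewrite /= polarise_zz -scaleN1r (linear_add (proj1 z_merge_stable)).
rewrite (linear_scale (proj1 z_merge_stable)) scaleN1r !mE.
rewrite [X in _ - X - _]/zz_comm /= lieC opprK -/(zz_comm m).
by rewrite scaler_nat mulr2n; apply: I_refl.
Qed.

(** Substitutions place each of the four parts of an element of [J] in [J] itself; the generators
    found for each part then place it in [J']. *)
Theorem T_ideal_relatively_fg J : 2%N \notin [pchar K] ->
  T_ideal J -> I `<=` J ->
  exists2 S : set F, finite_set S /\ S `<=` J &
    forall J', T_ideal J' -> I `<=` J' -> S `<=` J' -> J `<=` J'.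
Proof.
move=> K2 JT IJ; have Js := T_ideal_subspace JT; have [J0 JD JZ] := Js.
have two0 : 2%:R != 0 :> K by move: K2; rewrite inE /=.
have [S0 [fin0 S0J] gen0] := pattern_family_noetherian IT y_family JT IJ.
have [S1 [fin1 S1J] gen1] := pattern_family_noetherian IT z_family JT IJ.
have [S2 [fin2 S2J] gen2] := pattern_family_noetherian IT zz_polar_family JT IJ.
(* The linear part needs at most one generator: a T-ideal containing one y contains them all. *)
pose Sy := [set yvar 0] `&` J.
exists (S0 `|` S1 `|` (S2 `|` Sy)).
  split; last by move=> a [[/S0J|/S1J]|[/S2J|[]]].
  by rewrite !finite_setU; do ?split=> //; apply: finite_setIl; apply: finite_set1.
move=> J' J'T IJ' SJ' a Ja; have J's := T_ideal_subspace J'T.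
have [J'0 J'D J'Z] := J's.
have diffJ b c : I (b - c) -> J b <-> J c by move/IJ; apply: subspace_diff.
have diffJ' b c : I (b - c) -> J' b <-> J' c by move/IJ'; apply: subspace_diff.
have [l [a0 [a1 [a2 [yl y0 z1 z2 aE]]]]] := spanning_decomposition a.
have Jla0 : J (l + a0).
  apply/(diffJ _ _ (z_zero_decomposition yl y0 z1 z2)); rewrite -aE.
  exact: (proj2 z_zero_stable).
have Ja12 : J (a1 + a2).
  have -> : a1 + a2 = a - (l + a0) by rewrite aE [RHS]addrC addKr.
  exact: subspaceB.
have Jopp : J (a2 - a1).
  apply/(diffJ _ _ (z_opp_decomposition z1 z2)).
  exact: (proj2 z_opp_stable).
(* Adding the images under [z -> z] and [z -> -z] leaves twice the quadratic part. *)
have Ja2 : J a2.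
  rewrite -(scalerK two0 a2); apply: JZ.
  have -> : 2%:R *: a2 = (a1 + a2) + (a2 - a1).
    by rewrite scaler_nat mulr2n addrCA [a1 + a2]addrC addrK.
  exact: JD.
have Ja1 : J a1 by rewrite -(addrK a2 a1); apply: subspaceB.
have Jl_only i : J (y_only i l).
  have [yol yoI] := y_only_stable i.
  have -> : y_only i l = y_only i (l + a0) - y_only i a0.
    by rewrite (linear_add yol) addrK.
  by apply: subspaceB => //; [apply: yoI|apply/IJ/y_only_yy].
have J'l_only i : J' (y_only i l).
  have [c lc] := y_only_y i yl.
  apply/(diffJ' _ _ lc); have := Jl_only i; move/(diffJ _ _ lc).
  (* A nonzero coefficient puts [yvar i], hence [yvar 0], in [J]; then [yvar 0] belongs to [Sy]. *)
  have [->|c0] := eqVneq c 0; first by rewrite scale0r.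
  move=> /(JZ c^-1); rewrite (scalerK c0) => Jyi; apply: J'Z.
  apply: (yvar_T_ideal (i := 0%N)) => //; apply: SJ'; right; right; split=> //.
  exact: yvar_T_ideal Jyi.
have [N lN] := y_only_sum yl; have {lN} lN := lN N (leqnn N).
have Jl : J l by apply/(diffJ _ _ lN); apply: (subspace_sum _ (f := y_only^~ l)).
have J'l : J' l by apply/(diffJ' _ _ lN); apply: (subspace_sum _ (f := y_only^~ l)).
have Ja0 : J a0 by rewrite -(addKr l a0) addrC; apply: subspaceB.
have J'a0 : J' a0 by apply: (gen0 J') => // b S0b; apply: SJ'; left; left.
have J'a1 : J' a1 by apply: (gen1 J') => // b S1b; apply: SJ'; left; right.
(* Only the polarised form reduces by [S2]; merging the variables then returns [2 *: a2]. *)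
have J'pol : J' (polarise a2).
  apply: (gen2 J') => //; first by move=> b S2b; apply: SJ'; right; left.
    exact: polarise_span.
  exact: (proj2 polarise_stable).
have J'a2 : J' a2.
  rewrite -(scalerK two0 a2); apply: J'Z.
  apply/(diffJ' _ _ (merge_polarise z2)).
  exact: (proj2 z_merge_stable).
by rewrite aE; apply: (J'D); apply: J'D.
Qed.

End SpanningCommutators.

(** * The three identities hold in the graded algebra of triangular matrices *)

Section UT3Identities.
Variable K : fieldType.
Local Notation G := (Gamma11 K).

(** The scalar multiples of [e_13], in zero-based indices. *)
Definition is_corner (A : UT3 K) :=
  forall i j : 'I_3, (i != 0) || (j != ord_max) -> UT3val A i j = 0.

Definition null_diag (A : UT3 K) := forall i : 'I_3, UT3val A i i = 0.

Lemma UT3_lower (A : UT3 K) (i j : 'I_3) : (j < i)%N -> UT3val A i j = 0.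
Proof. by case: A => A /= /is_upperP; apply. Qed.

Lemma lie_null_diag (A B : UT3 K) : null_diag (lie A B).
Proof.
move=> i; rewrite UT3val_lie !mxE -sumrB big1 // => l _.
case: (ltngtP l i) => [li|il|/val_inj ->].
- by rewrite !(UT3_lower _ li) !mul0r subrr.
- by rewrite !(UT3_lower _ il) !mulr0 subrr.
- by rewrite mulrC subrr.
Qed.

Lemma odd_null_diag (A : UT3 K) : G 1 A -> null_diag A.
Proof. by move=> A1 i; apply: A1; rewrite ?leqnn // /unit_deg subnn. Qed.

Lemma even_corner (A : UT3 K) : G 0 A -> null_diag A -> is_corner A.
Proof.
move=> A0 An i j ij; case: (ltngtP i j) => [lt_ij|lt_ji|/val_inj <-] //.
  apply: (A0 _ _ (ltnW lt_ij)); move: i j ij lt_ij.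
  by move=> [[|[|[|i]]] i3] [[|[|[|j]]] j3].
exact: UT3_lower.
Qed.

Lemma lie_corner g (A B : UT3 K) : G g A -> G g B -> is_corner (lie A B).
Proof.
move=> gA gB; apply: even_corner; last exact: lie_null_diag.
have := component_lie gA gB; suff -> : g + g = 0 by [].
by case: (Z2P g) => ->; apply/val_inj.
Qed.

(** A strictly upper triangular matrix annihilates [e_13] on both sides. *)
Lemma corner_lie0 (A B : UT3 K) : is_corner A -> null_diag B -> lie A B = 0.
Proof.
move=> Ac Bn; apply/val_inj/matrixP => i j.
rewrite [LHS]/= !mxE !big1 ?subrr // => l _.
- case: (eqVneq l 0) => [->|l0]; last by rewrite [UT3val A l j]Ac ?l0 ?mulr0.
  case: (eqVneq i 0) => [->|i0]; first by rewrite Bn mul0r.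
  by rewrite UT3_lower ?mul0r // lt0n.
- case: (eqVneq l ord_max) => [->|lm]; last by rewrite [UT3val A i l]Ac ?lm ?orbT ?mul0r.
  case: (eqVneq j ord_max) => [->|jm]; first by rewrite Bn mulr0.
  rewrite [UT3val B _ _]UT3_lower ?mulr0 // ltn_neqAle -ltnS ltn_ord andbT.
  exact: jm.
Qed.

(** A bracket of two elements of equal degree is even with zero diagonal, hence a multiple of
    [e_13]; in each identity it is bracketed with an element of zero diagonal. *)
Lemma Gamma11_identities :
  [/\ graded_identities G (id_yyz K), graded_identities G (id_zzz K) &
      graded_identities G (id_yyyy K)].
Proof.
have ys := yvar_deg K; have zs := zvar_deg K.
split=> phi [phiB phiG]; rewrite !phiB; apply: corner_lie0.
- by apply: (@lie_corner 0); apply: phiG.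
- by apply: odd_null_diag; apply: phiG.
- by apply: (@lie_corner 1); apply: phiG.
- by apply: odd_null_diag; apply: phiG.
- by apply: (@lie_corner 0); apply: phiG.
- exact: lie_null_diag.
Qed.

End UT3Identities.

Theorem theorem3p24 (K : fieldType) (K_infinite : infinite_set [set: K])
    (K_char : 2%N \notin [pchar K])
    (J : set (freeGLie K)) (J_T_ideal : T_ideal J)
    (Id_sub_J : graded_identities (Gamma11 K) `<=` J) :
  fg_T_ideal J.
Proof.
pose S0 := [set id_yyz K; id_zzz K; id_yyyy K].
have S0Id : S0 `<=` graded_identities (Gamma11 K).
  by have [? ? ?] := Gamma11_identities K; move=> a [[->|->]|->].
have IT := T_ideal_genP S0.
have S0I : S0 `<=` T_ideal_gen S0 by move=> a S0a I [_]; apply.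
have IJ : T_ideal_gen S0 `<=` J.
  by move=> a; apply; split=> // b /S0Id/Id_sub_J.
have [S [finS SJ] genS] := T_ideal_relatively_fg IT
  (S0I _ (or_introl (or_introl erefl))) (S0I _ (or_introl (or_intror erefl)))
  (S0I _ (or_intror erefl)) K_char J_T_ideal IJ.
(* [S] generates [J] only relative to the T-ideal of [S0], so the three identities join the
   generators. *)
exists (S0 `|` S).
  by rewrite !finite_setU; do ?split=> //; apply: finite_set1.
apply/seteqP; split=> a Ja.
  move=> I [IdT S0SI]; apply: (genS I) => // [b|b Sb]; last by apply: S0SI; right.
  by apply; split=> // c S0c; apply: S0SI; left.
by apply: Ja; split=> // b [/S0Id/Id_sub_J|/SJ].
Qed.
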